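(* Let $p\ge 5$ be a prime and let $b,c$ be integers. Set $d:=b^2-4c$ and suppose that $p\nmid d$. (i) If $p\mid c$, then $$\sum_{k=0}^{p-1}(2k+1)\frac{T_k(b,c)^4}{d^{2k}}\equiv p^2-p^2\frac{2c}{d}\pmod{p^4}.$$ (ii) If $p\mid b$, then $$\sum_{k=0}^{p-1}(2k+1)\frac{T_k(b,c)^4}{d^{2k}}\equiv p-p\frac{b^2}{4c}\pmod{p^4}.$$ (iii) If $p\nmid c$ and $p\nmid b$, then $$\sum_{k=0}^{p-1}(2k+1)\frac{T_k(b,c)^4}{d^{2k}}\equiv p+p^2\frac{b^2}{4c}\left(2q_p(b)-q_p(d)\right)+p^3\left(S^{(2)}_{p-1}\!\left(\frac{b^2}{d}\right)+\frac{d}{4c}\,L_2\!\left(\frac{b^2}{d}\right)+\frac{b^2}{4c}\left(q_p(b)-q_p(d)\right)^2\right)\pmod{p^4}.$$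
   Context: For integers $b,c$ and $n\ge 0$, $T_n(b,c)$ denotes the generalized central trinomial coefficient, i.e. the coefficient of $x^n$ in the expansion of $(x^2+bx+c)^n$. For an integer $a$ not divisible by $p$, $q_p(a):=(a^{p-1}-1)/p$ is the Fermat quotient. For a $p$-adic number $x$, $$L_2(x):=\sum_{k=1}^{p-1}\frac{x^k}{k^2},\qquad S^{(2)}_{p-1}(x):=\frac{2}{p}\left(\frac{2-(1-\sqrt{x})^p-(1+\sqrt{x})^p}{p}-\sum_{i=1}^{p-1}\frac{(1-\sqrt{x})^i+(1+\sqrt{x})^i}{i}\right)$$ (the expression defining $S^{(2)}_{p-1}(x)$ is unchanged under $\sqrt{x}\mapsto-\sqrt{x}$, so it is a polynomial in $x$ with rational coefficients and does not depend on the choice of square root). For rational numbers $u,v$, $u\equiv v\pmod{p^m}$ means that $u-v\in p^m\mathbb{Z}_{(p)}$, where $\mathbb{Z}_{(p)}$ is the ring of rationals with denominator not divisible by $p$. *)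

(* Defs.v *)
From mathcomp Require Import all_boot all_order all_algebra.
Set Implicit Arguments.
Unset Strict Implicit.
Unset Printing Implicit Defensive.
Import Order.TTheory GRing.Theory Num.Theory.
Local Open Scope ring_scope.

Definition trinomial_coef (n : nat) (b c : int) : int :=
  (('X^2 + b *: 'X + c%:P : {poly int}) ^+ n)`_n.

(* (a ^ (p-1) - 1) / p as a rational number; it is an integer when p is prime
   and does not divide a. *)
Definition fermat_quotient (p : nat) (a : int) : rat :=
  (a ^+ p.-1 - 1)%:~R / p%:R.

Definition L2 (F : fieldType) (p : nat) (x : F) : F :=
  \sum_(1 <= k < p) x ^+ k / k%:R ^+ 2.

(* The expression defining S^(2)_{p-1}(x), with the indeterminate 'X standing
   for the square root of x. *)
Definition S2_sqrt (p : nat) : {poly rat} :=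
  (2 / p%:R) *:
    (p%:R^-1 *: (2 - (1 - 'X) ^+ p - (1 + 'X) ^+ p)
     - \sum_(1 <= i < p) i%:R^-1 *: ((1 - 'X) ^+ i + (1 + 'X) ^+ i)).

(* S2_sqrt p is an even polynomial, and [even_poly] is the polynomial in
   x = 'X ^ 2 that it represents (S2_poly_sqrt); S2_sqrtE evaluates it at an
   actual square root of x, in any field where there is one. *)
Definition S2_poly (p : nat) : {poly rat} := even_poly (S2_sqrt p).

Definition S2 (p : nat) (x : rat) : rat := (S2_poly p).[x].

Definition int_localization (p : nat) : pred rat :=
  fun r => ~~ (p%:Z %| denq r)%Z.

Definition eq_mod_loc (p m : nat) (u v : rat) : Prop :=
  exists2 w : rat, w \in int_localization p & u - v = p%:R ^+ m * w.

Lemma S2_sqrtN p : S2_sqrt p \Po (- 'X) = S2_sqrt p.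
Proof.
have powN i : ((1 - 'X : {poly rat}) ^+ i) \Po (- 'X) = (1 + 'X) ^+ i.
  by rewrite rmorphXn /= rmorphB /= rmorph1 comp_polyX opprK.
have powP i : ((1 + 'X : {poly rat}) ^+ i) \Po (- 'X) = (1 - 'X) ^+ i.
  by rewrite rmorphXn /= rmorphD /= rmorph1 comp_polyX.
rewrite /S2_sqrt linearZ /= linearB /= linearZ /= !linearB /= powN powP.
rewrite rmorph_nat [X in X - _ = _]addrAC; congr (_ - _ *: _).
rewrite linear_sum; apply: eq_bigr => i _.
by rewrite linearZ /= linearD /= powN powP addrC.
Qed.

Lemma S2_poly_sqrt p : S2_poly p \Po 'X^2 = S2_sqrt p.
Proof.
have sq : ('X^2 : {poly rat}) \Po (- 'X) = 'X^2.
  by rewrite rmorphXn /= comp_polyX sqrrN.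
have EO := poly_even_odd (S2_sqrt p); rewrite -/(S2_poly p) in EO.
have := S2_sqrtN p; rewrite -{1}EO linearD /= rmorphM /= comp_polyX.
rewrite -!comp_polyA sq mulrN => /esym/eqP; rewrite -{1}EO.
rewrite (inj_eq (addrI _)) -addr_eq0 -mulr2n -mulr_natr mulf_eq0.
rewrite -polyC_natr polyC_eq0 pnatr_eq0 orbF => /eqP O0.
by rewrite -EO O0 addr0.
Qed.

Lemma S2_sqrtE (F : numFieldType) (p : nat) (x : rat) (y : F) :
  y ^+ 2 = ratr x ->
  ratr (S2 p x) =
    2 / p%:R * ((2 - (1 - y) ^+ p - (1 + y) ^+ p) / p%:R
                - \sum_(1 <= i < p) ((1 - y) ^+ i + (1 + y) ^+ i) / i%:R).
Proof.
move=> y2; have -> : ratr (S2 p x) = (map_poly ratr (S2_sqrt p)).[y].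
  rewrite -S2_poly_sqrt map_comp_poly horner_comp map_polyXn hornerXn y2.
  by rewrite horner_map.
have powB i : (map_poly ratr ((1 - 'X) ^+ i)).[y] = (1 - y) ^+ i.
  by rewrite rmorphXn /= rmorphB /= rmorph1 map_polyX !hornerE.
have powD i : (map_poly ratr ((1 + 'X) ^+ i)).[y] = (1 + y) ^+ i.
  by rewrite rmorphXn /= rmorphD /= rmorph1 map_polyX !hornerE.
have Zy (a : rat) q :
    (map_poly ratr (a *: q)).[y] = ratr a * (map_poly ratr q).[y] :> F.
  by rewrite (map_polyZ (ratr : {rmorphism rat -> F})) hornerZ.
rewrite /S2_sqrt Zy fmorph_div !rmorph_nat; congr (_ * _).
rewrite rmorphB hornerD hornerN Zy fmorphV !rmorph_nat mulrC.
rewrite !rmorphB !hornerD !hornerN powB powD rmorph_nat -polyC_natr hornerC.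
congr (_ - _); rewrite rmorph_sum horner_sum; apply: eq_bigr => i _.
by rewrite Zy rmorphD hornerD powB powD fmorphV rmorph_nat mulrC.
Qed.

(* Main.v *)
Require Import Defs.
From HB Require Import structures.
From mathcomp Require Import all_boot all_order all_algebra all_field.
From mathcomp Require Import ring lra zify.
Import Order.TTheory GRing.Theory Num.Theory.
Set Implicit Arguments.
Unset Strict Implicit.
Local Open Scope ring_scope.

(** Put [y = c / d] and [x = b ^ 2 / d = 1 + 4 y], and let [P_k] be the Legendre
    polynomial, [P_k (1 + 2 v) = sum_j e_j v ^ j] with
    [e_j = C(k, j) C(k + j, j)].  The trinomial coefficients are values of Legendre
    polynomials, and a formula of Clausen type ([legendre_sqr],
    [trinomial_coef_sqr]) gives [T_k ^ 2 / d ^ k = Lambda P_k], where [Lambda] is the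
    linear functional sending [v ^ j] to [C(2j, j) y ^ j].  So the sum to be computed
    is [sum_(k < p) (2 k + 1) (Lambda P_k) ^ 2].

    This is [Lambda], applied in each of two variables, to the Christoffel-Darboux
    kernel of the Legendre polynomials.  That kernel has the closed form
    [(p / 2) (P_p (V) P_(p-1) (W) - P_(p-1) (V) P_p (W)) / (v - w)] with
    [V = 1 + 2 v] and [W = 1 + 2 w], so the sum becomes a bilinear expression in the
    coefficients of [P_p] and [P_(p-1)] ([christoffel_darboux]).  Half the sum and
    half the difference of these two polynomials have p-adically transparent
    coefficients: with [u_j = prod_(1 <= l <= j) (p ^ 2 / l ^ 2 - 1)], which is
    [(-1) ^ j] modulo [p ^ 2], they are [p ^ 2 u_(j-1) / j ^ 2] and
    [p u_(j-1) / j] for [j > 0] ([cd_form_half]).  Hence modulo [p ^ 4] only three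
    kinds of terms survive ([sum_clausen_sqr_mod4]), with [s = 4 y = x - 1] and
    [m = (p - 1) / 2]:
      [p s ^ (p - 1) + p ^ 2 sum_(a < p - 1) (- s) ^ a / (a + 1)
       + p ^ 3 sum_(1 <= n <= m) x ^ n / n ^ 2].
    The powers of [s] come from [sum_i C(2i, i) C(2(n-i), n-i) = 4 ^ n].  The last
    sum comes from the incomplete convolutions of central binomial coefficients
    [G_j], each divisible by [p], that arise when the top terms [v ^ p] and [w ^ p]
    are paired with lower ones.  Modulo [p ^ 2], reflecting [C(2(p-r), p-r)] into
    [-2p / (r C(2r, r))] turns [G_j] into the sum of [sum_shifted_bin], which is
    evaluated by telescoping.

    It remains to rewrite the three terms.  The last sum is [S2 x] modulo [p]
    ([S2_mod_p]).  When [s] is a p-adic unit, the truncated logarithm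
    [sum_a (1 - x) ^ a / a] is [(1 - x ^ p - (1 - x) ^ p) / p - p L2 x] modulo
    [p ^ 2] ([sum_log_mod3]), which cancels [p s ^ (p - 1)] and leaves
    [p (x ^ p - 1) / s + p ^ 3 (S2 x + L2 x / s)].  Expanding [x ^ (p - 1)] in Fermat
    quotients gives (iii), and [x = 0] modulo [p ^ 2] gives (ii).  When [p] divides
    [c], [s] is divisible by [p] and the three-term formula gives (i) directly. *)

(** * Legendre coefficients *)

Lemma natS_neq0 (n : nat) : n%:R + 1 != 0 :> rat.
Proof. by rewrite natr1 pnatr_eq0. Qed.

(** The coefficient [C(t, j) C(t + j, j)] of [v ^ j] in [P_t (1 + 2 v)].  A rational
    argument [t] makes [t + 1] and [t - 1] available without case distinctions at
    [0]. *)
Definition legendre_coef (t : rat) (j : nat) : rat :=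
  \prod_(l < j) ((t - l%:R) * (t + l%:R + 1) / (l%:R + 1) ^+ 2).

Lemma legendre_coef0 t : legendre_coef t 0 = 1.
Proof. by rewrite /legendre_coef big_ord0. Qed.

Lemma legendre_coefS t j :
  legendre_coef t j.+1
  = (t - j%:R) * (t + j%:R + 1) / (j%:R + 1) ^+ 2 * legendre_coef t j.
Proof. by rewrite /legendre_coef big_ord_recr /= mulrC. Qed.

(** Coefficients of three consecutive Legendre polynomials are rational multiples
    of a single coefficient of lower index; the three-term recurrence then reduces
    to an identity of rational functions. *)
Lemma legendre_coef_succ t j :
  legendre_coef (t + 1) j.+1
  = (t + j%:R + 1) * (t + j%:R + 2) / (j%:R + 1) ^+ 2 * legendre_coef t j.
Proof.
elim: j => [|j IHj]; first by rewrite legendre_coefS !legendre_coef0; field.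
rewrite legendre_coefS IHj legendre_coefS -!natr1.
have := natS_neq0 j; have := natS_neq0 j.+1; rewrite -natr1 => h1 h2.
by field; rewrite h1 h2.
Qed.

Lemma legendre_coef_pred t j :
  legendre_coef (t - 1) j.+1
  = (t - j%:R) * (t - j%:R - 1) / (j%:R + 1) ^+ 2 * legendre_coef t j.
Proof.
elim: j => [|j IHj]; first by rewrite legendre_coefS !legendre_coef0; field.
rewrite legendre_coefS IHj legendre_coefS -!natr1.
have := natS_neq0 j; have := natS_neq0 j.+1; rewrite -natr1 => h1 h2.
by field; rewrite h1 h2.
Qed.

Lemma legendre_coef_small (n j : nat) : (n < j)%N -> legendre_coef n%:R j = 0.
Proof.
move=> lt_nj; rewrite /legendre_coef (bigD1 (Ordinal lt_nj)) //=.
by rewrite subrr !mul0r.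
Qed.

Lemma legendre_coef_bin (n j : nat) :
  legendre_coef n%:R j = ('C(n, j) * 'C(n + j, j))%:R.
Proof.
elim: j => [|j IHj]; first by rewrite legendre_coef0 addn0 !bin0.
rewrite legendre_coefS IHj.
have [lt_nj|le_jn] := ltnP n j; first by rewrite bin_small // [in RHS]bin_small 1?ltnW ?mulr0.
have e1 : (j%:R + 1) * 'C(n, j.+1)%:R = (n%:R - j%:R) * 'C(n, j)%:R :> rat.
  by rewrite natr1 -natrM mul_bin_left natrM natrB.
have e2 : (j%:R + 1) * 'C(n + j.+1, j.+1)%:R = (n%:R + j%:R + 1) * 'C(n + j, j)%:R :> rat.
  by rewrite -natrD !natr1 -!natrM addnS -mul_bin_diag.
apply: (mulfI (expf_neq0 2 (natS_neq0 j))); rewrite !natrM.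
transitivity (((j%:R + 1) * 'C(n, j.+1)%:R)
              * ((j%:R + 1) * 'C(n + j.+1, j.+1)%:R) : rat); last by ring.
by rewrite e1 e2; field; exact: natS_neq0.
Qed.

Definition legendre_poly (n : nat) : {poly rat} :=
  \poly_(j < n.+1) legendre_coef n%:R j.

Lemma coef_legendre_poly n j : (legendre_poly n)`_j = legendre_coef n%:R j.
Proof.
by rewrite coef_poly; case: ltnP => // lt_nj; rewrite legendre_coef_small.
Qed.

(** * The square of a Legendre polynomial

    In the variable [v] with [P_n (1 + 2 v)], set [Y = v (v + 1)].  Both sides of the
    square formula are killed by the symmetric square of the Legendre operator. *)
Local Notation Y := ('X^2 + 'X : {poly rat}).

Lemma derivCM (c : rat) (f : {poly rat}) : (c%:P * f)^`() = c%:P * f^`().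
Proof. by rewrite derivM derivC mul0r add0r. Qed.

(** Divisibility by ['X ^ K]. *)
Definition vanishes_below (K : nat) (f : {poly rat}) :=
  forall i, (i < K)%N -> f`_i = 0.

Lemma vanishes_below_deriv K f :
  vanishes_below K.+1 f -> vanishes_below K f^`().
Proof. by move=> f0 i iK; rewrite coef_deriv f0 ?mul0rn. Qed.

Lemma coef_mulY f i :
  (Y * f)`_i.+1 = f`_i + (if i is i'.+1 then f`_i' else 0).
Proof.
have -> : Y * f = 'X * f + 'X * ('X * f) by ring.
rewrite coefD !coefXM /=; case: i => [|i]; rewrite /= ?addr0 //.
Qed.

Lemma vanishes_below_mulY K f :
  vanishes_below K f -> vanishes_below K.+1 (Y * f).
Proof.
move=> f0 [|i] iK; first by rewrite mulrDl coefD coefXnM coefXM.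
rewrite coef_mulY f0 // add0r; case: i iK => // i iK.
by rewrite f0 // -ltnS ltnW.
Qed.

Lemma coef_mulY_lowest K f :
  vanishes_below K f -> (Y * f)`_K.+1 = f`_K.
Proof.
move=> f0; rewrite coef_mulY; case: K f0 => [|K] f0; rewrite ?addr0 //.
by rewrite (f0 K) ?addr0.
Qed.

(** If [(Y f')' = N f], then [g = f ^ 2] satisfies
    [(Y (Y g')')' = 2 N ((Y g)' + Y g')]: this is the third order equation of the
    symmetric square. *)
Definition square_ode (N : rat) (f : {poly rat}) : {poly rat} :=
  (Y * (Y * f^`())^`())^`() - (2 * N)%:P * ((Y * f)^`() + Y * f^`()).

Lemma square_odeB N f g :
  square_ode N (f - g) = square_ode N f - square_ode N g.
Proof. by rewrite /square_ode !(derivB, mulrBr) ; ring. Qed.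

Lemma square_odeD N f g :
  square_ode N (f + g) = square_ode N f + square_ode N g.
Proof. by rewrite /square_ode !(derivD, mulrDr) ; ring. Qed.

Lemma square_odeZ N a f : square_ode N (a *: f) = a *: square_ode N f.
Proof.
by rewrite /square_ode; do ![rewrite derivZ | rewrite -scalerAr]; 
   rewrite -scalerDr -scalerAr scalerBr.
Qed.

(** At [v = 0] the indicial equation is [k ^ 3 = 0], so a polynomial solution is
    determined by its constant term: a lowest term [f_k v ^ k] with [k > 0]
    contributes [k ^ 3 f_k] in degree [k - 1]. *)
Lemma square_ode_uniq N f : square_ode N f = 0 -> f`_0 = 0 -> f = 0.
Proof.
move=> of0 f0; suff low K : vanishes_below K.+1 f.
  by apply/polyP => i; rewrite coef0 (low i).
elim: K => [|K IHK]; first by case.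
move=> i; rewrite ltnS leq_eqVlt => /orP[/eqP->|]; last exact: IHK.
have d1 := vanishes_below_deriv IHK.
have d2 := vanishes_below_mulY d1.
have d3 := vanishes_below_deriv d2.
have := congr1 (fun q : {poly rat} => q`_K) of0.
rewrite coef0 /square_ode coefB coefCM coefD d2 // addr0.
rewrite (vanishes_below_deriv (vanishes_below_mulY IHK)) // mulr0 subr0.
rewrite coef_deriv (coef_mulY_lowest d3) coef_deriv (coef_mulY_lowest d1).
rewrite coef_deriv => /eqP; rewrite !mulrn_eq0 /= => /eqP //.
Qed.

Lemma legendre_ode n :
  (Y * (legendre_poly n)^`())^`() = (n%:R * (n%:R + 1))%:P * legendre_poly n.
Proof.
have dE (f : {poly rat}) i : f^`()`_i = (i%:R + 1) * f`_i.+1.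
  by rewrite coef_deriv -[LHS]mulr_natl natr1.
apply/polyP => i; rewrite coefCM dE coef_mulY dE !coef_legendre_poly.
rewrite legendre_coefS; have hi := natS_neq0 i.
case: i hi => [|i] hi; first by field.
by move: hi; rewrite dE coef_legendre_poly -natr1 => hi; field.
Qed.

Lemma square_ode_legendre n :
  square_ode (n%:R * (n%:R + 1)) (legendre_poly n ^+ 2) = 0.
Proof.
rewrite /square_ode; have := legendre_ode n.
move: (n%:R * (n%:R + 1)) => N; set P := legendre_poly n; set Q := P^`() => ode.
have dPP : (P ^+ 2)^`() = 2%:P * (P * Q).
  by rewrite expr2 derivM -/Q polyC_natr; ring.
have -> : Y * (P ^+ 2)^`() = 2%:P * (P * (Y * Q)) by rewrite dPP; ring.
set Z := Y * Q in ode *.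
rewrite derivCM (derivM P Z) -/Q ode.
have -> : Y * (2%:P * (Q * Z + P * (N%:P * P)))
   = 2%:P * (Z * Z) + (2 * N)%:P * (Y * (P ^+ 2)).
  by rewrite polyCM /Z !polyC_natr; ring.
rewrite derivD !derivCM (derivM Z Z) ode polyCM !polyC_natr; ring.
Qed.

Definition clausen_coef (n j : nat) : rat :=
  legendre_coef n%:R j * 'C(2 * j, j)%:R.

Lemma central_binS j :
  (j%:R + 1) * 'C(2 * j.+1, j.+1)%:R = 2 * (2 * j%:R + 1) * 'C(2 * j, j)%:R :> rat.
Proof.
have E : (j.+1 * 'C(2 * j.+1, j.+1) = 2 * (2 * j).+1 * 'C(2 * j, j))%N.
  have mid : 'C((2 * j).+1, j) = 'C((2 * j).+1, j.+1).
    rewrite -(@bin_sub (2 * j).+1 j.+1); last by lia.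
    by congr 'C(_, _); lia.
  rewrite mulnS -mul_bin_diag mid.
  by have := mul_bin_diag (2 * j).+1 j; rewrite /=; nia.
by rewrite natr1 -natrM E !natrM -[(2 * j).+1%:R]natr1 natrM.
Qed.

Lemma clausen_coefS n j :
  (j%:R + 1) ^+ 3 * clausen_coef n j.+1
  = 2 * (2 * j%:R + 1) * (n%:R * (n%:R + 1) - j%:R * (j%:R + 1))
    * clausen_coef n j.
Proof.
rewrite /clausen_coef legendre_coefS.
transitivity ((j%:R + 1) ^+ 2 * ((n%:R - j%:R) * (n%:R + j%:R + 1) / (j%:R + 1) ^+ 2 *
 legendre_coef n%:R j) * ((j%:R + 1) * 'C(2 * j.+1, j.+1)%:R)); first by ring.
by rewrite central_binS; field; exact: natS_neq0.
Qed.

Lemma derivY : Y^`() = 2%:P * 'X + 1.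
Proof. by rewrite derivD derivXn derivX /= polyC_natr expr1 mulr_natl. Qed.

Lemma derivYn j : (Y ^+ j.+1)^`() = (j%:R + 1)%:P * ((2%:P * 'X + 1) * Y ^+ j).
Proof. by rewrite deriv_exp derivY /= -[LHS]mulr_natl natr1 !polyC_natr. Qed.

Lemma mulY_derivYn j : Y * (Y ^+ j)^`() = j%:R%:P * ((2%:P * 'X + 1) * Y ^+ j).
Proof.
case: j => [|j]; first by rewrite expr0 derivC mulr0 mul0r.
by rewrite derivYn -natr1 [Y ^+ j.+1]exprS; ring.
Qed.

(** On powers of [Y] the operator is a two-term shift, which is why the solution in
    powers of [Y] is hypergeometric. *)
Lemma square_ode_Yn N j :
  square_ode N (Y ^+ j.+1) = (2%:P * 'X + 1) *
    ((((j%:R + 1) ^+ 3)%:P * Y ^+ j)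
     - (2 * (2 * (j%:R + 1) + 1) * (N - (j%:R + 1) * (j%:R + 2)))%:P * Y ^+ j.+1).
Proof.
have e1 : Y * (Y * (Y ^+ j.+1)^`())^`()
  = ((j%:R + 1) ^+ 2)%:P * Y ^+ j.+1
    + (4 * (j%:R + 1) ^+ 2 + 2 * (j%:R + 1))%:P * Y ^+ j.+2.
  rewrite mulY_derivYn derivCM derivM derivYn derivD derivCM derivX derivC.
  rewrite -natr1 [Y ^+ j.+2]exprS [Y ^+ j.+1]exprS.
  rewrite !(polyCM, polyCD, polyC_exp) !polyC_natr; ring.
rewrite /square_ode e1 mulY_derivYn -[Y * Y ^+ j.+1]exprS.
rewrite derivD !derivCM !derivYn -!natr1 [Y ^+ j.+1]exprS.
by rewrite !(polyCM, polyCD, polyCB, polyC_exp) !polyC_natr; ring.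
Qed.

(** The recurrence [clausen_coefS] makes the sum telescope; the remainder vanishes
    at [K = n]. *)
Lemma square_ode_clausen_partial n K :
  square_ode (n%:R * (n%:R + 1)) (\sum_(j < K.+1) clausen_coef n j *: Y ^+ j)
  = - (clausen_coef n K * (2 * (2 * K%:R + 1)
       * (n%:R * (n%:R + 1) - K%:R * (K%:R + 1)))) *: ((2%:P * 'X + 1) * Y ^+ K).
Proof.
set N := n%:R * (n%:R + 1).
elim: K => [|K IHK].
  rewrite big_ord1 square_odeZ expr0 -mulrN -[RHS]scalerA; congr (_ *: _).
  have d1 : (1 : {poly rat})^`() = 0 by rewrite -polyC1 derivC.
  have d0 : (0 : {poly rat})^`() = 0 by rewrite -polyC0 derivC.
  rewrite /square_ode !(d1, d0, mulr0, mulr1, addr0, sub0r) derivY.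
  by rewrite -mul_polyC !(polyCM, polyCD, polyCB, polyCN) !polyC_natr; ring.
rewrite big_ord_recr /= square_odeD IHK square_odeZ square_ode_Yn.
have aS : 2 * (2 * K%:R + 1) * (N - K%:R * (K%:R + 1)) * clausen_coef n K
   = (K%:R + 1) ^+ 3 * clausen_coef n K.+1 by rewrite clausen_coefS.
have -> : clausen_coef n K * (2 * (2 * K%:R + 1) * (N - K%:R * (K%:R + 1))) = 
  (K%:R + 1) ^+ 3 * clausen_coef n K.+1 by rewrite -aS; ring.
move: (clausen_coef n K.+1) => a; rewrite -natr1.
rewrite -!mul_polyC; move: N {aS IHK} => N.
rewrite !(rmorphD, rmorphB, rmorphN, rmorphM, rmorphXn, rmorph1, rmorph_nat) /=.
ring.
Qed.

(** Clausen-type formula; the constant terms, both equal to 1, select the same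
    solution. *)
Lemma legendre_sqr n :
  legendre_poly n ^+ 2 = \sum_(j < n.+1) clausen_coef n j *: Y ^+ j.
Proof.
apply/eqP; rewrite -subr_eq0; apply/eqP.
apply: (@square_ode_uniq (n%:R * (n%:R + 1))).
  rewrite square_odeB square_ode_legendre square_ode_clausen_partial.
  by rewrite subrr !mulr0 oppr0 scale0r subr0.
rewrite coefB expr2 coef0M coef_legendre_poly legendre_coef0.
rewrite big_ord_recl coefD expr0 coefZ coef1 /clausen_coef legendre_coef0.
rewrite coef_sum big1 ?addr0 ?mulr1 ?bin0 ?subrr // => i _.
by rewrite coefZ -horner_coef0 !hornerE -exprM expr0n muln_eq0 /= mulr0.
Qed.

(** * Trinomial coefficients as Legendre values *)

Lemma coef_XaddC_exp (R : comNzRingType) (a : R) (m n : nat) :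
  (('X + a%:P) ^+ (m + n))`_n = a ^+ m *+ 'C(m + n, n).
Proof.
rewrite exprDn coef_sum.
have lt_m : (m < (m + n).+1)%N by rewrite ltnS leq_addr.
rewrite (bigD1 (Ordinal lt_m)) //= big1 => [|i]; last first.
  rewrite -val_eqE /= => im.
  rewrite coefMn -rmorphXn coefMC coefXn; case: eqP => [e|]; last by rewrite mul0r mul0rn.
  by have := ltn_ord i; lia.
rewrite addr0 coefMn -rmorphXn coefMC addKn coefXn eqxx mul1r.
by rewrite -bin_sub ?leq_addr // addKn.
Qed.

(** When [x ^ 2 + b x + c = (x + u) (x + u + w)], expanding the [n]-th power of the
    second factor in powers of [x + u] gives [w ^ n P_n (1 + 2 u / w)]. *)
Lemma trinomial_coef_roots (b c : int) (u w : algC) (n : nat) :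
  b%:~R = 2 * u + w -> c%:~R = u * (u + w) ->
  (trinomial_coef n b c)%:~R
  = \sum_(j < n.+1) ('C(n, j) * 'C(n + j, j))%:R * u ^+ j * w ^+ (n - j).
Proof.
move=> eb ec; rewrite /trinomial_coef -(coef_map (intr : int -> algC)) /=.
rewrite rmorphXn /= !rmorphD /= map_polyXn linearZ /= map_polyX map_polyC /=.
rewrite eb ec.
have -> : 'X^2 + (2 * u + w) *: 'X + (u * (u + w))%:P
        = ('X + u%:P) * (w%:P + ('X + u%:P)).
  by rewrite -mul_polyC !(polyCM, polyCD); ring.
rewrite exprMn [(w%:P + _) ^+ n]exprDn mulr_sumr coef_sum; apply: eq_bigr => j _.
rewrite mulrnAr coefMn mulrCA -exprD -rmorphXn /= coefCM addnC coef_XaddC_exp.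
rewrite -[LHS]mulr_natl -[u ^+ j *+ _]mulr_natl natrM.
by rewrite -(@bin_sub (j + n) j) ?leq_addr // addKn; ring.
Qed.

(** With [w ^ 2 = d] one has [v = u / w] and [v (v + 1) = c / d], so the square is
    rational although [w] need not be. *)
Lemma trinomial_coef_sqr (n : nat) (b c d : int) :
  d = b ^+ 2 - 4 * c -> d != 0 ->
  (trinomial_coef n b c)%:~R ^+ 2 = 
  d%:~R ^+ n * \sum_(j < n.+1) clausen_coef n j * (c%:~R / d%:~R) ^+ j :> rat.
Proof.
move=> dE d0; apply: (fmorph_inj (ratr : rat -> algC)).
rewrite rmorphXn rmorphM rmorphXn /= !ratr_int.
have [w w2] : exists w : algC, w ^+ 2 = d%:~R.
  by exists (sqrtC d%:~R); rewrite sqrtCK.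
have w0 : w != 0 by rewrite -sqrf_eq0 w2 intr_eq0.
have [u eb] : exists u : algC, b%:~R = 2 * u + w.
  by exists ((b%:~R - w) / 2); field.
have ec : c%:~R = u * (u + w).
  have e : 4 * c%:~R = b%:~R ^+ 2 - w ^+ 2 :> algC.
    by rewrite w2 dE rmorphB rmorphXn rmorphM /=; ring.
  have -> : c%:~R = (4 * c%:~R) / 4 :> algC by field.
  by rewrite e eb; field.
have Tw : (trinomial_coef n b c)%:~R
          = w ^+ n * (map_poly ratr (legendre_poly n)).[u / w].
  rewrite (trinomial_coef_roots n eb ec).
  rewrite (@horner_coef_wide _ n.+1); last first.
    by rewrite size_map_poly size_poly.
  rewrite mulr_sumr; apply: eq_bigr => j _.
  rewrite coef_map coef_legendre_poly legendre_coef_bin /= rmorph_nat.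
  have jn : (j <= n)%N by rewrite -ltnS.
  rewrite -[in w ^+ n](subnK jn) exprD exprMn exprVn.
  have: w ^+ j != 0 by rewrite expf_neq0.
  by move: (w ^+ j) (w ^+ (n - j)) (u ^+ j) => X Z U X0; field.
rewrite Tw exprMn -exprM mulnC exprM w2; congr (_ * _).
rewrite -horner_exp -rmorphXn /= legendre_sqr rmorph_sum horner_sum rmorph_sum.
apply: eq_bigr => j _.
rewrite -mul_polyC rmorphM /= map_polyC hornerM hornerC [RHS]rmorphM /=.
congr (_ * _); rewrite !rmorphXn /= horner_exp rmorphD /= map_polyXn map_polyX.
rewrite !hornerE fmorph_div /= !ratr_int -w2 ec; congr (_ ^+ _).
by field.
Qed.

(** * A Christoffel-Darboux identity *)

(** Multiplication by the variable, on coefficient sequences. *)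
Definition shift (f : nat -> rat) (j : nat) : rat :=
  if j is j'.+1 then f j' else 0.

(** Three-term recurrence of the Legendre polynomials, arranged as nested
    combinations of two sequences to match [cd_form_lin]. *)
Lemma legendre_coef_rec t j :
  (t + 1) * legendre_coef (t + 1) j =
  (2 * t + 1) * legendre_coef t j
  + 1 * (2 * (2 * t + 1) * shift (legendre_coef t) j
         + (- t) * legendre_coef (t - 1) j).
Proof.
case: j => [|j]; first by rewrite /= !legendre_coef0; ring.
rewrite /= legendre_coef_succ legendre_coef_pred legendre_coefS.
by have := natS_neq0 j => hj; field.
Qed.

Section ChristoffelDarboux.
Variable lam : nat -> rat.

(** The value on [(v ^ a w ^ b - v ^ b w ^ a) / (v - w)] of the functional sending
    [v ^ i w ^ j] to [lam i * lam j]. *)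
Definition cd_moment (a b : nat) : rat :=
  \sum_(b <= i < a) lam i * lam ((a + b).-1 - i)
  - \sum_(a <= i < b) lam i * lam ((a + b).-1 - i).

Lemma cd_momentC a b : cd_moment b a = - cd_moment a b.
Proof. by rewrite /cd_moment addnC opprB. Qed.

Lemma cd_moment_shift a b :
  cd_moment a.+1 b - cd_moment a b.+1 = 2 * (lam a * lam b).
Proof.
wlog le_ba : a b / (b <= a)%N => [hw|].
  have [/hw//|/ltnW/hw] := leqP b a.
  by rewrite (cd_momentC a b.+1) (cd_momentC a.+1 b) (mulrC (lam a)); lra.
rewrite /cd_moment addSn addnS /= [\sum_(a.+1 <= _ < b) _]big_geq ?leqW // subr0.
rewrite big_nat_recr //= addKn.
have [lt_ba|] := ltnP b a.
  rewrite [\sum_(a <= _ < b.+1) _]big_geq // subr0 big_ltn // addnK; ring.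
move=> le_ab; have -> : a = b by apply/eqP; rewrite eqn_leq le_ab.
by rewrite big_nat1 !big_geq // addKn; ring.
Qed.

(** The bilinear extension of [cd_moment] to coefficient sequences, cut off at a
    common bound [N] so that sequences need no size. *)
Definition cd_form (N : nat) (f g : nat -> rat) : rat :=
  \sum_(a < N) \sum_(b < N) f a * g b * cd_moment a b.

Lemma cd_formC N f g : cd_form N g f = - cd_form N f g.
Proof.
rewrite /cd_form exchange_big -sumrN; apply: eq_bigr => a _.
by rewrite -sumrN; apply: eq_bigr => b _; rewrite (cd_momentC a) mulrN (mulrC (g b)).
Qed.

Lemma cd_form_diag N f : cd_form N f f = 0.
Proof. by have := cd_formC N f f; lra. Qed.

Lemma cd_form_lin N f1 f2 g x y :
  cd_form N (fun j => x * f1 j + y * f2 j) g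
  = x * cd_form N f1 g + y * cd_form N f2 g.
Proof.
rewrite /cd_form !mulr_sumr -big_split; apply: eq_bigr => a _ /=.
by rewrite !mulr_sumr -big_split; apply: eq_bigr => b _ /=; ring.
Qed.

(** For a single polynomial [f] the kernel [(v f(v) f(w) - w f(v) f(w)) / (v - w)]
    is [f(v) f(w)], on which the functional is multiplicative. *)
Lemma cd_form_shift N f : f N = 0 ->
  cd_form N.+1 (shift f) f = (\sum_(j < N.+1) lam j * f j) ^+ 2.
Proof.
move=> fN.
have -> : cd_form N.+1 (shift f) f =
    \sum_(a < N.+1) \sum_(b < N.+1) f a * f b * cd_moment a.+1 b.
  rewrite /cd_form big_ord_recl [RHS]big_ord_recr /=.
  rewrite big1 => [|b _]; last by rewrite !mul0r.
  rewrite [X in _ = _ + X]big1 => [|b _]; last by rewrite fN !mul0r.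
  by rewrite addr0 add0r; apply: eq_bigr => a _; rewrite /= /bump add1n.
set F := \sum_(a < _) _; suff : F + F = 2 * (\sum_(j < N.+1) lam j * f j) ^+ 2.
  by lra.
rewrite {1}/F {1}exchange_big /F -big_split /= expr2 mulr_suml mulr_sumr.
apply: eq_bigr => a _; rewrite -big_split mulr_sumr mulr_sumr.
apply: eq_bigr => b _ /=; rewrite (cd_momentC a b.+1).
have -> : cd_moment a b.+1 = cd_moment a.+1 b - 2 * (lam a * lam b).
  by rewrite -cd_moment_shift; ring.
by ring.
Qed.

(** The recurrence expresses [(n + 1) cd_form P_(n+1) P_n] through [P_n] shifted,
    [P_n] itself, which contributes nothing by antisymmetry, and [P_(n-1)], which
    contributes the preceding value; what is left is the [n]-th summand. *)
Lemma christoffel_darboux N n : (n <= N)%N ->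
  2 * \sum_(0 <= k < n) (2 * k + 1)%:R
        * (\sum_(j < N.+1) lam j * legendre_coef k%:R j) ^+ 2
  = n%:R * cd_form N.+1 (legendre_coef n%:R) (legendre_coef (n%:R - 1)).
Proof.
elim: n => [|n IHn] lt_nN; first by rewrite big_geq // mulr0 mul0r.
rewrite big_nat_recr //= mulrDr IHn 1?ltnW // -[in RHS]natr1 addrK.
have eN : legendre_coef n%:R N = 0 by rewrite legendre_coef_small.
rewrite -(cd_form_shift eN).
have -> : (n%:R + 1) * cd_form N.+1 (legendre_coef (n%:R + 1)) (legendre_coef n%:R)
   = cd_form N.+1 (fun j => (2 * n%:R + 1) * legendre_coef n%:R j
  + 1 * (2 * (2 * n%:R + 1) * shift (legendre_coef n%:R) j
         + (- n%:R) * legendre_coef (n%:R - 1) j)) (legendre_coef n%:R).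
  rewrite /cd_form mulr_sumr; apply: eq_bigr => a _.
  rewrite mulr_sumr; apply: eq_bigr => b _.
  by rewrite -legendre_coef_rec; ring.
rewrite cd_form_lin cd_form_lin cd_form_diag.
rewrite (cd_formC _ (legendre_coef n%:R) (legendre_coef (n%:R - 1))) natrD natrM; ring.
Qed.

End ChristoffelDarboux.

(** With [S n] the convolution and [T n] the same sum weighted by [i], symmetry
    gives [2 T n = n S n] and the recurrence of [C(2i, i)] gives
    [T (n + 1) = 4 T n + 2 S n]; hence [S (n + 1) = 4 S n]. *)
Lemma sum_central_bin n :
  \sum_(0 <= i < n.+1) 'C(2 * i, i)%:R * 'C(2 * (n - i), n - i)%:R = 4 ^+ n :> rat.
Proof.
pose h i : rat := 'C(2 * i, i)%:R.
pose S n := \sum_(0 <= i < n.+1) h i * h (n - i)%N.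
pose T n := \sum_(0 <= i < n.+1) i%:R * (h i * h (n - i)%N).
rewrite -/(S n).
have T2 k : 2 * T k = k%:R * S k.
  have -> : 2 * T k = T k + \sum_(0 <= i < k.+1) (k - i)%:R * (h i * h (k - i)%N).
    rewrite [X in _ = _ + X]big_nat_rev /= add0n.
    have -> : \sum_(0 <= i < k.+1) (k - (k.+1 - i.+1))%:R *
       (h (k.+1 - i.+1)%N * h (k - (k.+1 - i.+1))%N) = T k.
      rewrite /T !big_nat; apply: eq_bigr => i /andP[_ ik].
      by rewrite subSS subKn // (mulrC (h _)).
    by ring.
  rewrite /T /S -big_split mulr_sumr /= !big_nat; apply: eq_bigr => i /andP[_ ik].
  by rewrite natrB //; ring.
have TS k : T k.+1 = 4 * T k + 2 * S k.
  rewrite /T big_nat_recl // mul0r add0r /S !mulr_sumr -big_split /=.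
  rewrite !big_nat; apply: eq_bigr => i _.
  by rewrite subSS -natr1 mulrA central_binS /h; ring.
have SS k : S k.+1 = 4 * S k.
  have := T2 k.+1; rewrite TS => e.
  apply: (mulfI (natS_neq0 k)); rewrite natr1 -e.
  by rewrite mulrDr mulrCA T2 -[k.+1%:R]natr1; ring.
elim: n => [|n IHn]; first by rewrite /S big_nat1 /h !bin0 mulr1 expr0.
by rewrite SS IHn exprS.
Qed.

(** The product [C(t - 1, j) C(t + j, j)], a common factor of the coefficients of
    [P_t] and [P_(t-1)].  It is even in [t], hence [(-1) ^ j] modulo [p ^ 2] at
    [t = p]. *)
Definition square_prod (t : rat) (j : nat) : rat :=
  \prod_(l < j) (t ^+ 2 / (l%:R + 1) ^+ 2 - 1).

Lemma square_prodS t j :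
  square_prod t j.+1 = (t ^+ 2 / (j%:R + 1) ^+ 2 - 1) * square_prod t j.
Proof. by rewrite /square_prod big_ord_recr /= mulrC. Qed.

Lemma square_prod0 t : square_prod t 0 = 1.
Proof. by rewrite /square_prod big_ord0. Qed.

Lemma legendre_coef_square_prod t j :
  legendre_coef t j.+1
  = t * (t + j%:R + 1) / (j%:R + 1) ^+ 2 * square_prod t j.
Proof.
elim: j => [|j IHj].
  by rewrite legendre_coefS legendre_coef0 square_prod0; field.
have := natS_neq0 j; have := natS_neq0 j.+1.
rewrite legendre_coefS IHj square_prodS -!natr1 => h1 h2.
by field; rewrite h1 h2.
Qed.

Lemma legendre_coef_pred_square_prod t j :
  legendre_coef (t - 1) j.+1
  = t * (t - j%:R - 1) / (j%:R + 1) ^+ 2 * square_prod t j.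
Proof.
have j0 := natS_neq0 j.
elim: j j0 => [|j IHj] h1.
  by rewrite legendre_coefS legendre_coef0 square_prod0; field.
have h2 := natS_neq0 j; move: h1.
rewrite legendre_coefS (IHj h2) square_prodS -!natr1 => h1.
by field; rewrite h1 h2.
Qed.

Lemma cd_moment_central0 (y : rat) (n : nat) :
  cd_moment (fun i => 'C(2 * i, i)%:R * y ^+ i) n.+1 0 = (4 * y) ^+ n.
Proof.
rewrite /cd_moment [X in _ - X]big_geq // subr0 addn0 /= exprMn -sum_central_bin.
rewrite mulr_suml !big_nat; apply: eq_bigr => i /andP[_ ltin].
by rewrite mulrACA -exprD subnKC.
Qed.

(** * Binomial sums *)

Lemma coef_1DX_exp (c : rat) (i k : nat) :
  ((1 + c *: 'X) ^+ i)`_k = c ^+ k * 'C(i, k)%:R.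
Proof.
rewrite exprDn coef_sum.
under eq_bigr => l _ do
  rewrite expr1n mul1r exprZn coefMn coefZ coefXn.
have [le_ki|lt_ik] := leqP k i; last first.
  rewrite bin_small // mulr0 big1 // => l _; have ltl := ltn_ord l.
  by rewrite (_ : (k == l) = false) ?mulr0 ?mul0rn //; apply/eqP; lia.
rewrite (bigD1 (Ordinal (le_ki : (k < i.+1)%N))) //= eqxx big1 => [|l].
  by rewrite addr0 mulr1 -[LHS]mulr_natr.
by rewrite -val_eqE /= eq_sym => /negbTE ->; rewrite mulr0 mul0rn.
Qed.

Lemma binomialD1 (R : comNzRingType) (t : R) (n M : nat) : (n <= M)%N ->
  (1 + t) ^+ n = 1 + \sum_(l < M) 'C(n, l.+1)%:R * t ^+ l.+1.
Proof.
move=> le_nM; rewrite exprDn.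
transitivity (\sum_(l < M.+1) 'C(n, l)%:R * t ^+ l); last first.
  by rewrite big_ord_recl bin0 mulr1.
rewrite (big_ord_widen_cond M.+1 predT
           (fun l => 1 ^+ (n - l) * t ^+ l *+ 'C(n, l))) ?ltnS //.
rewrite big_mkcond; apply: eq_bigr => l _ /=.
rewrite ltnS expr1n mul1r mulr_natl; case: leqP => // lt_nl.
by rewrite bin_small ?mulr0n.
Qed.

Lemma binS_ratio (n l : nat) :
  'C(n.+1, l.+1)%:R / (n%:R + 1) = 'C(n, l)%:R / (l%:R + 1) :> rat.
Proof.
have e : (n%:R + 1) * 'C(n, l)%:R = (l%:R + 1) * 'C(n.+1, l.+1)%:R :> rat.
  by rewrite !natr1 -!natrM -mul_bin_diag.
have n0 := natS_neq0 n; have l0 := natS_neq0 l.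
have -> : 'C(n, l)%:R = (l%:R + 1) * 'C(n.+1, l.+1)%:R / (n%:R + 1) :> rat.
  by rewrite -e; field.
by field; rewrite n0 l0.
Qed.

Lemma sum_binS_ratio (N l : nat) :
  \sum_(n < N) 'C(n.+1, l.+1)%:R / (n%:R + 1) = 'C(N, l.+1)%:R / (l%:R + 1) :> rat.
Proof.
elim: N => [|N IHN]; first by rewrite big_ord0 bin0n mul0r.
by rewrite big_ord_recr IHN /= binS_ratio binS natrD mulrDl.
Qed.

(** Re-expansion of a truncated logarithm around [1]. *)
Lemma sum_expD1_ratio (t : rat) (N : nat) :
  \sum_(n < N) (1 + t) ^+ n.+1 / (n%:R + 1)
  = \sum_(n < N) (n%:R + 1)^-1
    + \sum_(l < N) 'C(N, l.+1)%:R / (l%:R + 1) * t ^+ l.+1.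
Proof.
transitivity (\sum_(n < N) ((n%:R + 1)^-1 +
     \sum_(l < N) 'C(n.+1, l.+1)%:R / (n%:R + 1) * t ^+ l.+1)).
  apply: eq_bigr => n _; rewrite (@binomialD1 _ _ n.+1 N) // mulrDl mul1r.
  by rewrite mulr_suml; congr (_ + _); apply: eq_bigr => l _; rewrite mulrAC.
rewrite big_split /= exchange_big; congr (_ + _); apply: eq_bigr => l _.
by rewrite -sum_binS_ratio mulr_suml.
Qed.

(** Re-expansion of a truncated dilogarithm around [1]; the right-hand side is the
    shape in which the convolutions of central binomial coefficients arrive. *)
Lemma sum_expD1_ratio2 (s : rat) (m M : nat) : (m <= M)%N ->
  \sum_(n < m) (1 + s) ^+ n.+1 / (n%:R + 1) ^+ 2
  = \sum_(n < m) (n%:R + 1) ^- 2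
    + \sum_(l < M) s ^+ l.+1 / (l%:R + 1) * \sum_(n < m) 'C(n, l)%:R / (n%:R + 1).
Proof.
move=> le_mM.
transitivity (\sum_(n < m) ((n%:R + 1) ^- 2 +
     \sum_(l < M) s ^+ l.+1 / (l%:R + 1) * ('C(n, l)%:R / (n%:R + 1)))).
  apply: eq_bigr => n _; rewrite (@binomialD1 _ _ n.+1 M) ?(leq_trans _ le_mM) //.
  rewrite mulrDl mul1r mulr_suml; congr (_ + _); apply: eq_bigr => l _.
  have n0 := natS_neq0 n; have l0 := natS_neq0 l.
  transitivity (s ^+ l.+1 / (n%:R + 1) * ('C(n.+1, l.+1)%:R / (n%:R + 1))).
    by field.
  by rewrite binS_ratio; field; rewrite n0 l0.
rewrite big_split /= exchange_big; congr (_ + _); apply: eq_bigr => l _.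
by rewrite mulr_sumr.
Qed.

(** For [r <= m] this is [C(m, r + j) / C(m, r)]. *)
Definition shifted_bin (m j r : nat) : rat :=
  \prod_(i < j) ((m%:R - r%:R - i%:R) / (r%:R + i%:R + 1)).

Lemma shifted_binS m j r : shifted_bin m j.+1 r
  = (m%:R - r%:R - j%:R) / (r%:R + j%:R + 1) * shifted_bin m j r.
Proof. by rewrite /shifted_bin big_ord_recr /= mulrC. Qed.

Lemma shifted_bin0r m r : shifted_bin m 0 r = 1.
Proof. by rewrite /shifted_bin big_ord0. Qed.

Lemma natDS_neq0 (r j : nat) : r%:R + j%:R + 1 != 0 :> rat.
Proof. by rewrite -natrD natS_neq0. Qed.

Lemma shifted_bin_up m j r :
  (r%:R + 1 + j%:R) * shifted_bin m.+1 j r.+1 = (r%:R + 1) * shifted_bin m j r.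
Proof.
elim: j => [|j IHj]; first by rewrite !shifted_bin0r addr0.
have := natDS_neq0 r.+1 j; have := natDS_neq0 r j.
rewrite !shifted_binS -!natr1 => h1 h2.
transitivity ((m%:R - r%:R - j%:R) / (r%:R + j%:R + 1)
  * ((r%:R + 1 + j%:R) * shifted_bin m.+1 j r.+1)); first by field; rewrite h1 h2.
by rewrite IHj; field.
Qed.

Lemma shifted_bin_left m j r :
  (m%:R - r%:R - j%:R) * shifted_bin m.+1 j r.+1
  = (m%:R - r%:R) * shifted_bin m j r.+1.
Proof.
elim: j => [|j IHj]; first by rewrite !shifted_bin0r subr0.
have := natDS_neq0 r.+1 j; rewrite !shifted_binS -!natr1 => h.
transitivity ((m%:R - r%:R - (j%:R + 1)) / (r%:R + 1 + j%:R + 1)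
  * ((m%:R - r%:R - j%:R) * shifted_bin m.+1 j r.+1)); first by field.
by rewrite IHj; field.
Qed.

Lemma shifted_bin_r0 m j : shifted_bin m j 0 = 'C(m, j)%:R.
Proof.
elim: j => [|j IHj]; first by rewrite shifted_bin0r bin0.
rewrite shifted_binS IHj subr0 add0r; apply: (mulfI (natS_neq0 j)).
rewrite natr1 -[in RHS]natrM mul_bin_left.
have [le_jm|lt_mj] := leqP j m; last by rewrite bin_small // muln0 !mulr0.
by rewrite natrM natrB // -natr1; field; exact: natS_neq0.
Qed.

Lemma shifted_bin_small m j r : (r <= m)%N -> (m < r + j)%N -> shifted_bin m j r = 0.
Proof.
move=> le_rm lt_m; have lt_j : (m - r < j)%N by lia.
rewrite /shifted_bin (bigD1 (Ordinal lt_j)) //= natrB //.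
by rewrite subrr !mul0r.
Qed.

Lemma shifted_bin_diag m j : shifted_bin m j m = (j == 0)%:R.
Proof.
by case: j => [|j]; rewrite ?shifted_bin0r // shifted_bin_small //= addnS ltnS leq_addr.
Qed.

(** Both sides vanish at [m = 0], and the increment in [m] of the left-hand side
    telescopes in [r]: by [shifted_bin_up] and [shifted_bin_left], [m + 1] times its
    [r]-th term is [shifted_bin m j r - shifted_bin m j r.+1]. *)
Lemma sum_shifted_bin m j :
  \sum_(r < m) shifted_bin m j r.+1 / (r%:R + 1) = \sum_(n < m) 'C(n, j)%:R / (n%:R + 1).
Proof.
elim: m => [|m IHm]; first by rewrite !big_ord0.
rewrite !big_ord_recr /= -IHm shifted_bin_diag.
suff -> : 'C(m, j)%:R / (m%:R + 1) =
   \sum_(r < m) (shifted_bin m.+1 j r.+1 - shifted_bin m j r.+1) / (r%:R + 1)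
   + (j == 0)%:R / (m%:R + 1) :> rat.
  rewrite addrA -big_split; congr (_ + _); apply: eq_bigr => r _ /=; ring.
have -> : \sum_(r < m) (shifted_bin m.+1 j r.+1 - shifted_bin m j r.+1) / (r%:R + 1)
   = \sum_(0 <= r < m) (m%:R + 1)^-1 * (shifted_bin m j r - shifted_bin m j r.+1).
  rewrite big_mkord; apply: eq_bigr => r _.
  have m0 := natS_neq0 m; have r0 := natS_neq0 r.
  have e1 := shifted_bin_up m j r; have e2 := shifted_bin_left m j r.
  have -> : shifted_bin m j r =
    (r%:R + 1 + j%:R) * shifted_bin m.+1 j r.+1 / (r%:R + 1) by rewrite e1; field.
  apply: (mulfI m0); apply: (mulfI r0).
  transitivity ((m%:R + 1) * shifted_bin m.+1 j r.+1 - (m%:R + 1) * shifted_bin m j r.+1).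
    by field.
  transitivity ((r%:R + 1 + j%:R) * shifted_bin m.+1 j r.+1
               - (r%:R + 1) * shifted_bin m j r.+1); last by field; rewrite m0 r0.
  lra.
rewrite -mulr_sumr.
have -> : \sum_(0 <= r < m) (shifted_bin m j r - shifted_bin m j r.+1)
          = shifted_bin m j 0 - shifted_bin m j m.
  rewrite -[RHS]opprB -telescope_sumr // -sumrN.
  by apply: eq_bigr => r _; rewrite opprB.
by rewrite shifted_bin_r0 shifted_bin_diag; field; exact: natS_neq0.
Qed.

(** * The localization at p and its ideals *)

Section PAdic.
Variable p : nat.
Hypothesis p_pr : prime p.

Local Notation Zp := (int_localization p).

Lemma p_neq0 : p%:R != 0 :> rat.
Proof. by rewrite pnatr_eq0 -lt0n prime_gt0. Qed.

Lemma Euclid_dvdzM (a b : int) : (p%:Z %| a * b)%Z = (p%:Z %| a)%Z || (p%:Z %| b)%Z.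
Proof. by rewrite !dvdzE abszM Euclid_dvdM. Qed.

Lemma int_localizationP (u : rat) :
  reflect (exists a b : int, ~~ (p%:Z %| b)%Z /\ u = a%:~R / b%:~R) (u \in Zp).
Proof.
apply: (iffP idP) => [pu|[a [b [pb ->]]]].
  by exists (numq u), (denq u); rewrite divq_num_den.
apply: contra pb => pd; set x := _ / _ in pd.
have [->|b0] := eqVneq b 0; first exact: dvdz0.
apply: (dvdz_trans pd).
have xE : numq x * b = a * denq x.
  apply/eqP; rewrite -(eqr_int rat) !rmorphM /= -eqr_div ?intr_eq0 ?denq_neq0 //.
  by rewrite divq_num_den.
rewrite -(@Gauss_dvdzr _ (numq x)) ?xE ?dvdz_mull //.
by rewrite coprimezE coprime_sym coprime_num_den.
Qed.

Lemma int_localization_subring : subring_closed Zp.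
Proof.
have B0 b : ~~ (p%:Z %| b)%Z -> b%:~R != 0 :> rat.
  by apply: contraNneq => /eqP; rewrite intr_eq0 => /eqP ->.
split => [|_ _ /int_localizationP[a [b [pb ->]]] /int_localizationP[c [d [pd ->]]]
          |_ _ /int_localizationP[a [b [pb ->]]] /int_localizationP[c [d [pd ->]]]];
  apply/int_localizationP.
- by exists 1, 1; split; rewrite // dvdzE absz1 dvdn1 neq_ltn prime_gt1 ?orbT.
- exists (a * d - c * b), (b * d); split; first by rewrite Euclid_dvdzM negb_or pb.
  by rewrite rmorphB !rmorphM /=; field; rewrite !B0.
exists (a * c), (b * d); split; first by rewrite Euclid_dvdzM negb_or pb.
by rewrite !rmorphM /=; field; rewrite !B0.
Qed.

HB.instance Definition _ :=
  GRing.isSubringClosed.Build rat Zp int_localization_subring.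

Lemma int_localization_invz (b : int) : ~~ (p%:Z %| b)%Z -> b%:~R^-1 \in Zp.
Proof. by move=> pb; apply/int_localizationP; exists 1, b; rewrite mul1r. Qed.

Lemma int_localization_invn (n : nat) : ~~ (p %| n)%N -> n%:R^-1 \in Zp.
Proof. by move=> pn; have := @int_localization_invz n; rewrite dvdzE; apply. Qed.

Lemma int_localization_invS (n : nat) : (n.+1 < p)%N -> (n%:R + 1)^-1 \in Zp.
Proof.
by move=> lt_np; rewrite natr1 int_localization_invn // gtnNdvd.
Qed.

(** The ideal [p ^ k Z_(p)].  Congruences are memberships of differences, so that
    closure under sums is found by inference. *)
Definition p_ideal (k : nat) : pred rat := fun r => r / p%:R ^+ k \in Zp.

Lemma p_idealP k r :
  reflect (exists2 w, w \in Zp & r = p%:R ^+ k * w) (r \in p_ideal k).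
Proof.
have pk := expf_neq0 k p_neq0.
apply: (iffP idP) => [rk|[w wp ->]].
  by exists (r / p%:R ^+ k) => //; rewrite mulrC divfK.
by rewrite unfold_in mulrAC divff // mul1r.
Qed.

Lemma p_ideal_zmod k : zmod_closed (p_ideal k).
Proof.
split=> [|_ _ /p_idealP[u up ->] /p_idealP[w wp ->]]; apply/p_idealP.
  by exists 0; rewrite ?rpred0 ?mulr0.
by exists (u - w); rewrite ?rpredB // mulrBr.
Qed.

HB.instance Definition _ k := GRing.isZmodClosed.Build rat (p_ideal k) (p_ideal_zmod k).

Lemma eq_mod_locP k u v : u - v \in p_ideal k -> eq_mod_loc p k u v.
Proof. by move/p_idealP=> [w wp e]; exists w. Qed.

Lemma p_ideal0 r : (r \in p_ideal 0) = (r \in Zp).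
Proof. by rewrite unfold_in expr0 divr1. Qed.

Lemma p_idealM j k u w : u \in p_ideal j -> w \in p_ideal k -> u * w \in p_ideal (j + k).
Proof.
move=> /p_idealP[u' up ->] /p_idealP[w' wp ->]; apply/p_idealP.
by exists (u' * w'); rewrite ?rpredM // exprD mulrACA.
Qed.

Lemma p_idealMl k u w : u \in Zp -> w \in p_ideal k -> u * w \in p_ideal k.
Proof. by rewrite -p_ideal0 => up wk; have := p_idealM up wk. Qed.

Lemma p_idealMr k u w : u \in p_ideal k -> w \in Zp -> u * w \in p_ideal k.
Proof. by rewrite mulrC => uk wp; apply: p_idealMl. Qed.

Lemma p_ideal_exp k : p%:R ^+ k \in p_ideal k.
Proof. by apply/p_idealP; exists 1; rewrite ?rpred1 ?mulr1. Qed.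

Lemma p_ideal_p : p%:R \in p_ideal 1.
Proof. exact: (p_ideal_exp 1). Qed.

Lemma p_idealpM j k u : (p%:R ^+ j * u \in p_ideal (j + k)) = (u \in p_ideal k).
Proof.
apply/idP/idP => [/p_idealP[w wp e]|]; last exact/p_idealM/p_ideal_exp.
apply/p_idealP; exists w => //; apply: (mulfI (expf_neq0 j p_neq0)).
by rewrite e exprD mulrA.
Qed.

Lemma p_ideal_le j k u : (j <= k)%N -> u \in p_ideal k -> u \in p_ideal j.
Proof.
move=> jk /p_idealP[w wp ->]; apply/p_idealP; exists (p%:R ^+ (k - j) * w).
  by rewrite rpredM ?rpredX ?rpred_nat.
by rewrite mulrA -exprD subnKC.
Qed.

Lemma p_ideal_Zp k u : u \in p_ideal k -> u \in Zp.
Proof. by move/(p_ideal_le (leq0n k)); rewrite p_ideal0. Qed.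

Lemma p_ideal_cancel k a u : a != 0 -> a^-1 \in Zp -> a * u \in p_ideal k -> u \in p_ideal k.
Proof. by move=> a0 ap /(p_idealMl ap); rewrite mulKf. Qed.

Lemma p_ideal_dvd (n : nat) : (p %| n)%N -> n%:R \in p_ideal 1.
Proof.
by move=> /dvdnP[k ->]; apply/p_idealP; exists k%:R; rewrite ?rpred_nat // natrM mulrC.
Qed.

Lemma p_ideal_dvdz (n : int) : (p%:Z %| n)%Z -> n%:~R \in p_ideal 1.
Proof.
by move=> /dvdzP[k ->]; apply/p_idealP; exists k%:~R; rewrite ?rpred_int // rmorphM mulrC.
Qed.

Variable m : nat.
Hypothesis pE : p = (2 * m).+1.
Hypothesis p_ge5 : (5 <= p)%N.

Lemma fermat_Zp u : u \in Zp -> u ^+ p - u \in p_ideal 1.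
Proof.
have fermat_nat (n : nat) : n%:R ^+ p - n%:R \in p_ideal 1.
  rewrite -natrX; have /eqP := fermat_little n p_pr.
  have le_n : (n <= n ^ p)%N.
    case: (n) => [//|k]; rewrite -{1}(expn1 k.+1) leq_pexp2l //.
    exact: prime_gt0.
  by rewrite -natrB // => e; apply: p_ideal_dvd; rewrite -eqn_mod_dvd.
have fermat_int (a : int) : a%:~R ^+ p - a%:~R \in p_ideal 1.
  case: a => n; first exact: fermat_nat.
  have p_odd : odd p by rewrite pE /= oddM.
  rewrite NegzE mulrNz exprNn -signr_odd p_odd expr1 mulN1r -opprB opprK addrC rpredN.
  exact: fermat_nat.
move=> /int_localizationP[a [b [pb ->]]].
have b0 : b%:~R != 0 :> rat.
  by apply: contraNneq pb => /eqP; rewrite intr_eq0 => /eqP ->.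
have -> : (a%:~R / b%:~R) ^+ p - a%:~R / b%:~R = 
    b%:~R^-1 ^+ p.+1 * (b%:~R * (a%:~R ^+ p - a%:~R) - a%:~R * (b%:~R ^+ p - b%:~R)) :> rat.
  rewrite expr_div_n exprVn exprS; have : b%:~R ^+ p != 0 :> rat by rewrite expf_neq0.
  by move: (b%:~R ^+ p) (a%:~R ^+ p) => B A B0; field; rewrite b0 B0.
by rewrite p_idealMl ?rpredX ?int_localization_invz // rpredB // p_idealMl ?rpred_int.
Qed.

(** * Harmonic sums modulo p *)

Lemma invr_Zp (n : nat) : (0 < n < p)%N -> n%:R^-1 \in Zp.
Proof. by move=> /andP[n0 np]; rewrite int_localization_invn // gtnNdvd. Qed.

Lemma invr_sub_p (n : nat) : (0 < n < p)%N ->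
  (p - n)%:R ^- 2 - n%:R ^- 2 \in p_ideal 1.
Proof.
move=> np; have np' : (0 < p - n < p)%N by lia.
have n0 : n%:R != 0 :> rat by rewrite pnatr_eq0; lia.
have pn0 : (p - n)%:R != 0 :> rat by rewrite pnatr_eq0; lia.
have e : (p - n)%:R = p%:R - n%:R :> rat by rewrite natrB //; lia.
have -> : (p - n)%:R ^- 2 - n%:R ^- 2
  = p%:R * ((2 * n%:R - p%:R) * (p - n)%:R^-1 ^+ 2 * n%:R^-1 ^+ 2) :> rat.
  by rewrite e; field; rewrite n0 -e pn0.
apply: p_idealMr p_ideal_p _.
by rewrite !rpredM ?rpredB ?rpredM ?rpred_nat // invr_Zp.
Qed.

Lemma sum_mirror (f : nat -> rat) :
  \sum_(l < p.-1) f l.+1 = \sum_(l < m) (f l.+1 + f (p - l.+1)%N).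
Proof.
rewrite pE /= -(big_mkord predT (fun l => f l.+1)).
rewrite (@big_cat_nat _ _ _ m) //=; last by lia.
rewrite big_split /= big_mkord; congr (_ + _).
rewrite -{1}(add0n m) big_addn big_nat_rev big_mkord /=.
have -> : (2 * m - m = m)%N by lia.
by apply: eq_bigr => l _; congr f; have := ltn_ord l; lia.
Qed.

Lemma sum_even_mirror (f : nat -> rat) :
  \sum_(l < p.-1) f l.+1 = \sum_(l < m) (f (2 * l.+1)%N + f (p - 2 * l.+1)%N).
Proof.
have step k : \sum_(l < 2 * k) f l.+1
    = \sum_(l < k) (f (2 * l.+1)%N + f (2 * l).+1).
  elim: k => [|k IHk]; first by rewrite !big_ord0.
  have -> : (2 * k.+1 = (2 * k).+2)%N by lia.
  rewrite !big_ord_recr /= IHk -addrA; congr (_ + _); rewrite addrC.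
  by congr (f _ + _); lia.
rewrite pE /= step !big_split /=; congr (_ + _).
rewrite (reindex_inj rev_ord_inj) /=; apply: eq_bigr => l _; congr f.
by have := ltn_ord l; lia.
Qed.

(** The sum of [1 / l ^ 2] over [0 < l < p] can be folded by [l -> p - l] onto
    [l <= m], which gives twice the half sum [H], or onto the even [l], which gives
    [2 (H / 4)].  So [3 H / 2] vanishes modulo [p], and [p > 3]. *)
Lemma half_harmonic2 : \sum_(n < m) (n%:R + 1) ^- 2 \in p_ideal 1.
Proof.
pose f (n : nat) : rat := n%:R ^- 2; set H := \sum_(n < m) _.
have HE : H = \sum_(n < m) f n.+1 by apply: eq_bigr => n _; rewrite natr1.
have e1 : \sum_(l < p.-1) f l.+1 - 2 * H \in p_ideal 1.
  rewrite sum_mirror HE mulr_sumr -sumrB; apply: rpred_sum => l _.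
  have -> : f l.+1 + f (p - l.+1)%N - 2 * f l.+1 = f (p - l.+1)%N - f l.+1 by ring.
  by apply: invr_sub_p; have := ltn_ord l; lia.
have e2 : \sum_(l < p.-1) f l.+1 - 2^-1 * H \in p_ideal 1.
  rewrite sum_even_mirror HE mulr_sumr -sumrB; apply: rpred_sum => l _.
  have -> : f (2 * l.+1)%N + f (p - 2 * l.+1)%N - 2^-1 * f l.+1
           = f (p - 2 * l.+1)%N - f (2 * l.+1)%N.
    have l0 : l.+1%:R != 0 :> rat by rewrite pnatr_eq0.
    by rewrite {1 3 5}/f natrM; field; rewrite addrC natr1.
  by apply: invr_sub_p; have := ltn_ord l; lia.
have -> : H = (2 / 3%:R) * ((\sum_(l < p.-1) f l.+1 - 2^-1 * H)
                - (\sum_(l < p.-1) f l.+1 - 2 * H)) by field.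
apply: p_idealMl (rpredB e2 e1).
by rewrite rpredM ?rpred_nat ?invr_Zp //; lia.
Qed.

Lemma harmonic2 : \sum_(n < p.-1) (n%:R + 1) ^- 2 \in p_ideal 1.
Proof.
under eq_bigr do rewrite natr1.
rewrite (sum_mirror (fun n => n%:R ^- 2)).
have -> : \sum_(l < m) ((l.+1%:R ^- 2 : rat) + (p - l.+1)%:R ^- 2)
  = \sum_(l < m) ((p - l.+1)%:R ^- 2 - l.+1%:R ^- 2) + 2 * \sum_(n < m) (n%:R + 1) ^- 2.
  by rewrite mulr_sumr -big_split; apply: eq_bigr => l _ /=; rewrite natr1; ring.
rewrite rpredD ?p_idealMl ?rpred_nat ?half_harmonic2 // rpred_sum // => l _.
by apply: invr_sub_p; have := ltn_ord l; lia.
Qed.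

(** Wolstenholme: pairing [l] with [p - l] extracts one factor [p] and leaves
    [- sum 1 / l ^ 2] modulo [p], a second factor. *)
Lemma harmonic1 : \sum_(n < p.-1) (n%:R + 1)^-1 \in p_ideal 2.
Proof.
set H := \sum_(n < _) _; apply: (@p_ideal_cancel 2 2) => //.
  by rewrite invr_Zp //; lia.
have -> : 2 * H = p%:R ^+ 1 * (\sum_(n < p.-1) ((n%:R + 1)^-1 * (p%:R - (n%:R + 1))^-1)).
  have -> : 2 * H = H + H by ring.
  rewrite {2}/H (reindex_inj rev_ord_inj) -big_split mulr_sumr.
  apply: eq_bigr => n _ /=; have lt_n := ltn_ord n.
  have -> : (p.-1 - n.+1)%:R + 1 = p%:R - (n%:R + 1) :> rat.
    by rewrite !natr1 -natrB; [congr _%:R; lia | lia].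
  have n0 := natS_neq0 n; have pn0 : p%:R - (n%:R + 1) != 0 :> rat.
    by rewrite natr1 subr_eq0 eqr_nat; lia.
  by field; rewrite n0 pn0.
rewrite (p_idealpM 1 1).
have -> : \sum_(n < p.-1) ((n%:R + 1)^-1 * (p%:R - (n%:R + 1))^-1) =
    p%:R * \sum_(n < p.-1) ((n%:R + 1)^-1 ^+ 2 * (p - n.+1)%:R^-1)
    - \sum_(n < p.-1) (n%:R + 1) ^- 2 :> rat.
  rewrite mulr_sumr -sumrB; apply: eq_bigr => n _; have lt_n := ltn_ord n.
  have n0 := natS_neq0 n; have pn0 : p%:R - (n%:R + 1) != 0 :> rat.
    by rewrite natr1 subr_eq0 eqr_nat; lia.
  by rewrite natrB -?natr1; [field; rewrite n0 pn0 | lia].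
rewrite rpredB ?harmonic2 // p_idealMr ?p_ideal_p // rpred_sum // => n _.
have lt_n := ltn_ord n.
by rewrite rpredM ?rpredX ?invr_Zp ?int_localization_invS //; lia.
Qed.

(** * Central binomial coefficients modulo powers of p *)

Lemma square_prod_mod2 j : (j < p)%N ->
  square_prod p%:R j - (-1) ^+ j \in p_ideal 2.
Proof.
elim: j => [|j IHj] ltj; first by rewrite square_prod0 subrr rpred0.
have {}IHj := IHj (ltnW ltj); have jp := int_localization_invS ltj.
have ujp : square_prod p%:R j \in Zp.
  by rewrite -[X in X \in _](subrK ((-1) ^+ j)) rpredD ?rpredX ?rpredN1 ?(p_ideal_Zp IHj).
have -> : square_prod p%:R j.+1 - (-1) ^+ j.+1
  = p%:R ^+ 2 * ((j%:R + 1)^-1 ^+ 2 * square_prod p%:R j)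
    - (square_prod p%:R j - (-1) ^+ j).
  by rewrite square_prodS [_ ^+ j.+1]exprS; field; exact: natS_neq0.
by rewrite rpredB // p_idealMr ?p_ideal_exp // rpredM ?rpredX.
Qed.

(** One order better than [square_prod_mod2], because the coefficient of [p ^ 2] is
    a full harmonic sum of squares.  This number is [C(2p - 1, p - 1)]. *)
Lemma square_prod_last : square_prod p%:R p.-1 - 1 \in p_ideal 3.
Proof.
have H k : (k < p)%N -> square_prod p%:R k
   - (-1) ^+ k * (1 - p%:R ^+ 2 * \sum_(n < k) (n%:R + 1) ^- 2) \in p_ideal 3.
  elim: k => [|k IHk] ltk.
    by rewrite square_prod0 big_ord0 mulr0 subr0 mulr1 subrr rpred0.
  have {}IHk := IHk (ltnW ltk); have kp := int_localization_invS ltk.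
  rewrite big_ord_recr /= square_prodS.
  set u := square_prod _ _ in IHk *; set S := \sum_(_ < _) _ in IHk *.
  have -> : (p%:R ^+ 2 / (k%:R + 1) ^+ 2 - 1) * u
    - (-1) ^+ k.+1 * (1 - p%:R ^+ 2 * (S + (k%:R + 1) ^- 2))
    = (k%:R + 1)^-1 ^+ 2 * (p%:R ^+ 2 * (u - (-1) ^+ k))
      - (u - (-1) ^+ k * (1 - p%:R ^+ 2 * S)).
    by rewrite [_ ^+ k.+1]exprS; field; exact: natS_neq0.
  rewrite rpredB // p_idealMl ?rpredX // (p_ideal_le (k := 4)) // (p_idealpM 2 2).
  by rewrite square_prod_mod2 // ltnW.
have lt_p : (p.-1 < p)%N by rewrite prednK ?prime_gt0.
have sg : (-1) ^+ p.-1 = 1 :> rat by rewrite pE /= -signr_odd oddM.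
have := H _ lt_p; rewrite sg mul1r.
set S := \sum_(_ < _) _; set u := square_prod _ _ => h.
have -> : u - 1 = (u - (1 - p%:R ^+ 2 * S)) - p%:R ^+ 2 * S by ring.
by rewrite rpredB // (p_idealpM 2 1) harmonic2.
Qed.

Local Notation h i := ('C(2 * i, i)%:R : rat).

Lemma central_bin_mid i : (m < i < p)%N -> h i \in p_ideal 1.
Proof.
move=> /andP[mi ip]; apply: p_ideal_dvd.
have small k : (k < p)%N -> ~~ (p %| k`!)%N.
  elim: k => [|k IHk] ltk; first by rewrite fact0 dvdn1 neq_ltn prime_gt1 ?orbT.
  by rewrite factS Euclid_dvdM // negb_or gtnNdvd // IHk // ltnW.
have le_i : (i <= 2 * i)%N by lia.
have := bin_fact le_i; have -> : (2 * i - i = i)%N by lia.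
have : (p %| (2 * i)`!)%N by rewrite dvdn_fact // prime_gt0 //=; lia.
move=> + e; rewrite -e !Euclid_dvdM // => /orP[//|].
by rewrite orbb => pi; have := small _ ip; rewrite pi.
Qed.

(** For [k <= m], [C(2k, k)] is [(-4) ^ k C(m, k)] modulo [p], since
    [2 (2k + 1) = - 4 (m - k) + 2p]. *)
Lemma central_bin_ratio (r j : nat) : (r + j <= m)%N ->
  h (r + j)%N - (-4) ^+ j * shifted_bin m j r * h r \in p_ideal 1.
Proof.
elim: j => [|j IHj] ltm.
  by rewrite addn0 shifted_bin0r expr0 !mul1r subrr rpred0.
have {}IHj : h (r + j)%N - (-4) ^+ j * shifted_bin m j r * h r \in p_ideal 1.
  by apply: IHj; lia.
have kp : (r%:R + j%:R + 1)^-1 \in Zp.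
  by rewrite -natrD int_localization_invS //; lia.
have Xp : (-4) ^+ j * shifted_bin m j r * h r \in Zp.
  have -> : (-4) ^+ j * shifted_bin m j r * h r =
     h (r + j)%N - (h (r + j)%N - (-4) ^+ j * shifted_bin m j r * h r) by ring.
  by rewrite rpredB ?rpred_nat ?(p_ideal_Zp IHj).
have k0 := natDS_neq0 r j.
have hS : h (r + j).+1 = 2 * (2 * (r%:R + j%:R) + 1) / (r%:R + j%:R + 1) * h (r + j)%N.
  have := central_binS (r + j); rewrite natrD => e.
  by apply: (mulfI k0); rewrite e; field.
have pR : p%:R = 2 * m%:R + 1 :> rat by rewrite pE -natr1 natrM.
have -> : h (r + j.+1)%N - (-4) ^+ j.+1 * shifted_bin m j.+1 r * h r
  = 2 * (2 * (r%:R + j%:R) + 1) * (r%:R + j%:R + 1)^-1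
      * (h (r + j)%N - (-4) ^+ j * shifted_bin m j r * h r)
    + p%:R * (2 * (r%:R + j%:R + 1)^-1 * ((-4) ^+ j * shifted_bin m j r * h r)).
  rewrite addnS hS shifted_binS [_ ^+ j.+1]exprS pR; field; exact: k0.
apply: rpredD.
  apply: p_idealMl IHj; rewrite rpredM //.
  by rewrite !(rpredD, rpredM, rpred_nat, rpred1).
by apply: p_idealMr p_ideal_p _; rewrite rpredM // rpredM ?rpred_nat.
Qed.

(** The ratio of consecutive instances of [r C(2r, r) C(2(p-r), p-r)] is 1 modulo
    [p], and at [r = 1] the value is [2 C(2p - 2, p - 1)], which is [-2p]. *)
Lemma central_bin_mirror (r : nat) : (0 < r <= m)%N ->
  r%:R * h r * h (p - r)%N + 2 * p%:R \in p_ideal 2.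
Proof.
elim: r => [//|[|r] IHr /andP[_ rm]].
  have -> : h 1 = 2 by [].
  have p2E : (p.-2.+1 = p.-1)%N by lia.
  have p1E : p%:R - 1 = p.-1%:R :> rat by rewrite -subn1 natrB // prime_gt0.
  (* [C(2p - 2, p - 1)] is the leading coefficient of [P_(p-1)]. *)
  have hE : h p.-1 = p%:R / (p.-1%:R) ^+ 2 * square_prod p%:R p.-2.
    have -> : h p.-1 = legendre_coef (p%:R - 1) p.-1.
      by rewrite p1E legendre_coef_bin binn mul1n addnn mul2n.
    rewrite -p2E legendre_coef_pred_square_prod p2E.
    rewrite -[in RHS]p2E -[in RHS]natr1.
    have -> : p%:R - p.-2%:R - 1 = 1 :> rat.
      rewrite -addrA -opprD natr1 p2E -p1E; ring.
    by rewrite mulr1.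
  have p1p : (p%:R - 1)^-1 \in Zp by rewrite p1E invr_Zp //; lia.
  have p10 : p%:R - 1 != 0 :> rat by rewrite p1E pnatr_eq0; lia.
  have sg : (-1) ^+ p.-2 = -1 :> rat.
    by rewrite -signr_odd (_ : odd p.-2 = true) ?expr1 //; lia.
  have := @square_prod_mod2 p.-2; rewrite sg opprK subn1 hE -p1E => u2.
  have {}u2 : square_prod p%:R p.-2 + 1 \in p_ideal 2 by apply: u2; lia.
  have -> : 1%:R * 2 * (p%:R / (p%:R - 1) ^+ 2 * square_prod p%:R p.-2) + 2 * p%:R
    = 2 * p%:R * (p%:R - 1)^-1 ^+ 2 * (square_prod p%:R p.-2 + 1)
      + p%:R ^+ 2 * (2 * (p%:R - 1)^-1 ^+ 2 * (p%:R - 2)) :> rat.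
    by field.
  rewrite rpredD // ?(p_idealMr (p_ideal_exp 2)) //.
    by rewrite p_idealMl // !rpredM ?rpred_nat ?rpredX.
  by rewrite !rpredM ?rpredB ?rpred_nat ?rpredX.
have {}IHr : r.+1%:R * h r.+1 * h (p - r.+1)%N + 2 * p%:R \in p_ideal 2.
  by apply: IHr; lia.
have r0 : r.+1%:R != 0 :> rat by rewrite pnatr_eq0.
pose q := (p - r.+2)%N; have qE : (p - r.+1 = q.+1)%N by rewrite /q; lia.
have qR : q%:R = p%:R - r.+1%:R - 1 :> rat.
  by rewrite /q natrB -?natr1; [ring | lia].
(* [2 q + 1 = 2 p - (2 r + 3)], with [0 < 2 r + 3 < p]. *)
have qp : (2 * q%:R + 1)^-1 \in Zp.
  rewrite -natrM natr1 int_localization_invn //.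
  have : ~~ (p %| 2 * r.+1 + 1)%N by rewrite gtnNdvd //; lia.
  apply: contra => pq; rewrite -(dvdn_addr _ pq).
  by apply/dvdnP; exists 2; rewrite /q; lia.
have rp : r.+1%:R^-1 \in Zp by rewrite invr_Zp //; lia.
have q0 : 2 * q%:R + 1 != 0 :> rat by rewrite -natrM natS_neq0.
have hr := central_binS r.+1; have hq := central_binS q.
move: IHr; rewrite qE -/q -[r.+2%:R]natr1 hr.
have -> : h q = (q%:R + 1) / (2 * (2 * q%:R + 1)) * h q.+1.
  by rewrite mulrAC hq; field.
move: (h r.+1) (h q.+1) q0 qp => H K; rewrite qR.
have Rp : r.+1%:R \in Zp by rewrite rpred_nat.
move: (r.+1%:R) r0 rp Rp => R r0 rp Rp q0 qp fp.
have -> : 2 * (2 * R + 1) * H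
   * ((p%:R - R - 1 + 1) / (2 * (2 * (p%:R - R - 1) + 1)) * K) + 2 * p%:R
  = (2 * R + 1) * (p%:R - R) * (R^-1 * (2 * (p%:R - R - 1) + 1)^-1)
      * (R * H * K + 2 * p%:R)
    - p%:R ^+ 2 * (2 * (R^-1 * (2 * (p%:R - R - 1) + 1)^-1)).
  by field; rewrite q0 r0.
have rqp := rpredM rp qp; apply: rpredB.
  apply: p_idealMl fp; rewrite rpredM // rpredM ?rpredB ?rpred_nat //.
  by rewrite rpredD ?rpredM ?rpred_nat ?rpred1.
by apply: p_idealMr (p_ideal_exp 2) _; rewrite rpredM ?rpred_nat.
Qed.

Lemma central_bin_pair (j r : nat) : (r < m)%N -> (r.+1 + j <= m)%N ->
  h (p - r.+1)%N * h (r.+1 + j)%N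
  + 2 * p%:R * (-4) ^+ j * (shifted_bin m j r.+1 / (r%:R + 1)) \in p_ideal 2.
Proof.
move=> rm rjm.
have rp : (r%:R + 1)^-1 \in Zp by rewrite int_localization_invS //; lia.
have shp : shifted_bin m j r.+1 \in Zp.
  rewrite /shifted_bin rpred_prod // => i _; have ltij := ltn_ord i.
  by rewrite rpredM ?rpredB ?rpred_nat // -natrD int_localization_invS //; lia.
have hp1 : h (p - r.+1)%N \in p_ideal 1 by apply: central_bin_mid; lia.
have e1 := central_bin_ratio rjm.
have e2 : r.+1%:R * h r.+1 * h (p - r.+1)%N + 2 * p%:R \in p_ideal 2.
  by apply: central_bin_mirror; lia.
have -> : h (p - r.+1)%N * h (r.+1 + j)%N
  + 2 * p%:R * (-4) ^+ j * (shifted_bin m j r.+1 / (r%:R + 1))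
  = h (p - r.+1)%N * (h (r.+1 + j)%N - (-4) ^+ j * shifted_bin m j r.+1 * h r.+1)
    + (-4) ^+ j * shifted_bin m j r.+1 * (r%:R + 1)^-1
      * (r.+1%:R * h r.+1 * h (p - r.+1)%N + 2 * p%:R).
  by rewrite -[r.+1%:R]natr1; field; exact: natS_neq0.
apply: rpredD; first exact: (p_idealM hp1 e1).
by apply: p_idealMl e2; rewrite !rpredM ?rpredX ?rpredN ?rpred_nat.
Qed.

(** The indices of a pair add up to [p + j], more than [p - 1 = 2m], so at most one
    of the two is at most [m].  Pairs with no such index vanish modulo [p ^ 2], and
    exchanging the indices shows that those with one are twice the pairs whose
    second index is small, to which [central_bin_pair] applies. *)
Lemma sum_central_bin_pairs (j : nat) : (j < p.-1)%N ->
  \sum_(r < p.-1 - j) h (p - r.+1)%N * h (r.+1 + j)%N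
  - p%:R * ((-4) ^+ j.+1 * \sum_(n < m) 'C(n, j)%:R / (n%:R + 1)) \in p_ideal 2.
Proof.
move=> ltj; set t := fun r : nat => h (p - r.+1)%N * h (r.+1 + j)%N.
pose low r : rat := ((r.+1 + j <= m)%N)%:R * t r.
have e1 : \sum_(r < p.-1 - j) t r - 2 * \sum_(r < p.-1 - j) low r \in p_ideal 2.
  have -> : 2 * \sum_(r < p.-1 - j) low r
    = \sum_(r < p.-1 - j) (low r + ((p - r.+1 <= m)%N)%:R * t r).
    rewrite big_split /=; have -> (x : rat) : 2 * x = x + x by ring.
    congr (_ + _); rewrite (reindex_inj rev_ord_inj) /=; apply: eq_bigr => r _.
    have ltr := ltn_ord r; rewrite /low /t.
    have -> : ((p.-1 - j - r.+1).+1 + j = p - r.+1)%N by lia.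
    have -> : (p - (p.-1 - j - r.+1).+1 = r.+1 + j)%N by lia.
    by rewrite [h (r.+1 + j)%N * _]mulrC.
  rewrite -sumrB rpred_sum // => r _; have ltr := ltn_ord r.
  rewrite /low; have [rj|rj] := leqP (r.+1 + j) m; have [rp|rp] := leqP (p - r.+1) m.
  - by exfalso; lia.
  - by rewrite mul1r mul0r addr0 subrr rpred0.
  - by rewrite mul1r mul0r add0r subrr rpred0.
  rewrite !mul0r add0r subr0 /t; apply: (p_idealM (j := 1) (k := 1)).
    by apply: central_bin_mid; lia.
  by apply: central_bin_mid; lia.
(* Both ranges contain all [r] with [low r] nonzero. *)
have e2 : \sum_(r < p.-1 - j) low r = \sum_(r < m) low r.
  have [lejm|ltmj] := ltnP j m; last first.
    by rewrite !big1 // => r _; rewrite /low leqNgt (_ : (m < _)%N) ?mul0r //; lia.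
  rewrite -[LHS](big_mkord predT) -[RHS](big_mkord predT).
  rewrite (@big_cat_nat _ _ _ m) //=; last by lia.
  rewrite [X in _ + X]big_nat [X in _ + X]big1 ?addr0 // => r /andP[mr _].
  by rewrite /low leqNgt (_ : (m < _)%N) ?mul0r //; lia.
rewrite -sum_shifted_bin.
have -> : \sum_(r < p.-1 - j) t r - p%:R * ((-4) ^+ j.+1 *
    \sum_(r < m) shifted_bin m j r.+1 / (r%:R + 1))
  = (\sum_(r < p.-1 - j) t r - 2 * \sum_(r < p.-1 - j) low r)
   + 2 * \sum_(r < m) (low r + 2 * p%:R * (-4) ^+ j * (shifted_bin m j r.+1 / (r%:R + 1))).
  by rewrite big_split /= -mulr_sumr e2 exprS; ring.
apply: rpredD e1 _; apply: p_idealMl; first exact: rpred_nat.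
apply: rpred_sum => r _; have ltr := ltn_ord r; rewrite /low.
have [rj|rj] := leqP (r.+1 + j) m; first by rewrite mul1r central_bin_pair.
by rewrite mul0r add0r (@shifted_bin_small m j r.+1) // mul0r mulr0 rpred0.
Qed.

Variable y : rat.
Hypothesis y_Zp : y \in Zp.

Local Notation lam := (fun i : nat => h i * y ^+ i).
Local Notation G j := (cd_moment lam p j).

Lemma cd_moment_p (j : nat) : (j < p.-1)%N ->
  G j.+1 = y ^+ (p + j) * \sum_(r < p.-1 - j) h (p - r.+1)%N * h (r.+1 + j)%N.
Proof.
move=> ltj; rewrite /cd_moment [X in _ - X]big_geq ?subr0; last by lia.
rewrite big_nat_rev -{1}(add0n j.+1) big_addn big_mkord.
have -> : (p - j.+1 = p.-1 - j)%N by lia.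
rewrite mulr_sumr; apply: eq_bigr => r _; have ltr := ltn_ord r.
have -> : (j.+1 + p - (r + j.+1).+1 = p - r.+1)%N by lia.
have -> : ((p + j.+1).-1 - (p - r.+1) = r.+1 + j)%N by lia.
by rewrite mulrACA -exprD mulrC; congr (_ ^+ _ * _); lia.
Qed.

(** Fermat's congruence [y ^ p = y] brings the exponent [p + j] down to [j + 1]. *)
Lemma cd_moment_p_mod2 (j : nat) : (j < p.-1)%N ->
  G j.+1 - p%:R * ((-1) ^+ j.+1 * (4 * y) ^+ j.+1
                   * \sum_(n < m) 'C(n, j)%:R / (n%:R + 1)) \in p_ideal 2.
Proof.
move=> ltj; rewrite cd_moment_p //; have := sum_central_bin_pairs ltj.
set g := \sum_(r < _) _; set W := \sum_(n < m) _ => gW.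
have Wp : W \in Zp.
  rewrite rpred_sum // => n _; have ltn := ltn_ord n.
  by rewrite rpredM ?rpred_nat ?int_localization_invS //; lia.
have -> : y ^+ (p + j) * g - p%:R * ((-1) ^+ j.+1 * (4 * y) ^+ j.+1 * W)
  = y ^+ (p + j) * (g - p%:R * ((-4) ^+ j.+1 * W))
    + p%:R ^+ 1 * ((-4) ^+ j.+1 * W * y ^+ j * (y ^+ p - y)).
  have s4 : (-4) ^+ j.+1 = (-1) ^+ j.+1 * 4 ^+ j.+1 :> rat.
    by rewrite -exprMn mulN1r.
  by rewrite s4 exprMn [y ^+ j.+1]exprS exprD; ring.
apply: rpredD; first by rewrite p_idealMl ?rpredX.
rewrite (p_idealpM 1 1) p_idealMl ?fermat_Zp //.
by rewrite !rpredM ?rpredX ?rpredN ?rpred_nat.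
Qed.

(** * The sum modulo the fourth power of p *)

Lemma cd_moment_Zp a b : cd_moment lam a b \in Zp.
Proof.
by rewrite rpredB // rpred_sum // => i _; rewrite !rpredM ?rpredX ?rpred_nat.
Qed.

Lemma cd_moment_p_mod1 j : (j < p.-1)%N -> G j.+1 \in p_ideal 1.
Proof.
move=> ltj; rewrite cd_moment_p // p_idealMl ?rpredX // rpred_sum // => r _.
have ltr := ltn_ord r; have [lt_m|ge_m] := ltnP m (p - r.+1).
  by apply: p_idealMr; rewrite ?rpred_nat ?central_bin_mid //; lia.
by apply: p_idealMl; rewrite ?rpred_nat ?central_bin_mid //; lia.
Qed.

(** The coefficients of [(P_p + P_(p-1)) / 2] and [(P_p - P_(p-1)) / 2]. *)
Definition half_sum (j : nat) : rat :=
  if j is j'.+1 then p%:R ^+ 2 / (j'%:R + 1) ^+ 2 * square_prod p%:R j' else 1.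

Definition half_diff (j : nat) : rat :=
  if j is j'.+1 then p%:R / (j'%:R + 1) * square_prod p%:R j' else 0.

(** For an antisymmetric form, [<D + S, S - D> = 2 <D, S>]. *)
Lemma cd_form_half N :
  cd_form lam N (legendre_coef p%:R) (legendre_coef (p%:R - 1))
  = 2 * cd_form lam N half_diff half_sum.
Proof.
have e1 j : legendre_coef p%:R j = 1 * half_diff j + 1 * half_sum j.
  case: j => [|j]; first by rewrite legendre_coef0 /=; ring.
  by rewrite legendre_coef_square_prod /=; field; exact: natS_neq0.
have e2 j : legendre_coef (p%:R - 1) j = (-1) * half_diff j + 1 * half_sum j.
  case: j => [|j]; first by rewrite legendre_coef0 /=; ring.
  by rewrite legendre_coef_pred_square_prod /=; field; exact: natS_neq0.
pose f j := 1 * half_diff j + 1 * half_sum j.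
pose g j := (-1) * half_diff j + 1 * half_sum j.
transitivity (cd_form lam N f g).
  by apply: eq_bigr => a _; apply: eq_bigr => b _; rewrite e1 e2.
rewrite cd_form_lin (cd_formC _ _ g) (cd_formC _ _ g half_sum) !cd_form_lin.
by rewrite !cd_form_diag (cd_formC _ _ half_diff half_sum); ring.
Qed.

Lemma sum_to_p (f : nat -> rat) : \sum_(a < p) f a = \sum_(a < p.-1) f a + f p.-1.
Proof. by rewrite pE /= big_ord_recr. Qed.

(** The indices [0] and [p] carry the only coefficients of [half_sum] that are not
    divisible by [p ^ 2], and are set apart. *)
Lemma cd_form_half_split :
  cd_form lam p.+1 half_diff half_sum
  = \sum_(a < p.-1) half_diff a.+1 *
      ((4 * y) ^+ a + \sum_(b < p.-1) half_sum b.+1 * cd_moment lam a.+1 b.+1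
       - square_prod p%:R p.-1 * G a.+1)
    + square_prod p%:R p.-1 * ((4 * y) ^+ p.-1 + \sum_(b < p.-1) half_sum b.+1 * G b.+1).
Proof.
have pp : p.-1.+1 = p by rewrite prednK ?prime_gt0.
have pR : p.-1%:R + 1 = p%:R :> rat by rewrite natr1 pp.
have p0 := p_neq0.
have Ap : half_sum p = square_prod p%:R p.-1.
  by rewrite -{1}pp /= pR; field.
have Bp : half_diff p = square_prod p%:R p.-1.
  by rewrite -{1}pp /= pR; field.
have row a : \sum_(b < p.+1) half_diff a.+1 * half_sum b * cd_moment lam a.+1 b
  = half_diff a.+1 * ((4 * y) ^+ a
     + \sum_(b < p.-1) half_sum b.+1 * cd_moment lam a.+1 b.+1
     - square_prod p%:R p.-1 * cd_moment lam p a.+1).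
  transitivity (half_diff a.+1 * 1 * cd_moment lam a.+1 0
      + \sum_(b < p) half_diff a.+1 * half_sum b.+1 * cd_moment lam a.+1 b.+1).
    by rewrite big_ord_recl.
  rewrite cd_moment_central0 mulr1.
  rewrite (sum_to_p (fun b => half_diff a.+1 * half_sum b.+1 * cd_moment lam a.+1 b.+1)).
  rewrite pp Ap (cd_momentC _ p a.+1).
  under eq_bigr do rewrite -mulrA.
  by rewrite -mulr_sumr; ring.
rewrite /cd_form big_ord_recl big1 => [|b _]; last by rewrite !mul0r.
rewrite add0r; under eq_bigr do rewrite [nat_of_ord (lift _ _)]/(bump _ _) /bump /= add1n row.
rewrite (sum_to_p (fun a => half_diff a.+1 * ((4 * y) ^+ a
   + \sum_(b < p.-1) half_sum b.+1 * cd_moment lam a.+1 b.+1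
       - square_prod p%:R p.-1 * G a.+1))).
congr (_ + _); rewrite pp Bp; congr (_ * _).
have -> : cd_moment lam p p = 0 by rewrite /cd_moment !big_geq ?subrr.
by rewrite mulr0 subr0.
Qed.

(** Modulo [p ^ 3] the products of two inner coefficients drop out, and the pairing
    of an inner coefficient with the one of index [p] is given by
    [cd_moment_p_mod2].  The dilogarithm sum appears through [sum_expD1_ratio2], its
    constant term [half_harmonic2] being divisible by [p]. *)
Lemma cd_form_half_mod3 :
  cd_form lam p.+1 half_diff half_sum
  - ((4 * y) ^+ p.-1 + p%:R * \sum_(a < p.-1) (- (4 * y)) ^+ a / (a%:R + 1)
     + p%:R ^+ 2 * \sum_(n < m) (1 + 4 * y) ^+ n.+1 / (n%:R + 1) ^+ 2) \in p_ideal 3.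
Proof.
have le_mp : (m <= p.-1)%N by lia.
rewrite cd_form_half_split (sum_expD1_ratio2 _ le_mp).
have sp : 4 * y \in Zp by rewrite rpredM ?rpred_nat.
move: (4 * y) sp (cd_moment_p_mod2) => s sp G2.
set v := square_prod _ _; set H := \sum_(n < m) _.
set X' := \sum_(b < _) _ * G _.
have v1 : v - 1 \in p_ideal 3 by exact: square_prod_last.
have vp : v \in Zp by rewrite -[v](subrK 1) rpredD ?rpred1 ?(p_ideal_Zp v1).
have up a : (a < p.-1)%N -> square_prod p%:R a \in Zp.
  move=> lta; have /p_ideal_Zp : square_prod p%:R a - (-1) ^+ a \in p_ideal 2.
    by apply: square_prod_mod2; lia.
  by move=> h; rewrite -[X in X \in _](subrK ((-1) ^+ a)) rpredD ?rpredX ?rpredN1.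
have ip a : (a < p.-1)%N -> (a%:R + 1)^-1 \in Zp.
  by move=> lta; rewrite int_localization_invS //; lia.
have A2 b : (b < p.-1)%N -> half_sum b.+1 \in p_ideal 2.
  move=> ltb; rewrite /= -mulrA p_idealMr ?p_ideal_exp // rpredM ?up //.
  by rewrite -exprVn rpredX ?ip.
have X'3 : X' \in p_ideal 3.
  rewrite rpred_sum // => b _; have ltb := ltn_ord b.
  by rewrite (p_idealM (j := 2) (k := 1)) ?A2 ?cd_moment_p_mod1.
set F := \sum_(a < _) _ * (_ - _).
set P := \sum_(a < _) _ / _; set Q := \sum_(l < _) _ * _.
have -> : F + v * (s ^+ p.-1 + X') - (s ^+ p.-1 + p%:R * P + p%:R ^+ 2 * (H + Q))
  = (F - (p%:R * P + p%:R ^+ 2 * Q)) + (v - 1) * s ^+ p.-1 + v * X' - p%:R ^+ 2 * H by ring.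
rewrite rpredB ?(p_idealpM 2 1) ?half_harmonic2 // rpredD ?p_idealMl //.
rewrite rpredD ?p_idealMr ?rpredX // /F /P /Q !mulr_sumr -big_split -sumrB.
apply: rpred_sum => a _ /=; have lta := ltn_ord a.
have u2 : square_prod p%:R a - (-1) ^+ a \in p_ideal 2 by apply: square_prod_mod2; lia.
have := G2 a lta; have {}up := up a lta; have {}ip := ip a lta.
set X := \sum_(b < p.-1) _; set W := \sum_(n < m) _; set g := G _ => g2.
have X2 : X \in p_ideal 2.
  by rewrite rpred_sum // => b _; rewrite p_idealMr ?A2 ?cd_moment_Zp.
have g1 : g \in p_ideal 1 by apply: cd_moment_p_mod1.
move: u2 up; set u := square_prod _ _ => u2 up.
have sg : (-1) ^+ a * (-1) ^+ a = 1 :> rat by rewrite -expr2 sqrr_sign.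
have sgp : (-1) ^+ a \in Zp by rewrite rpredX ?rpredN1.
rewrite exprNn; rewrite exprS mulN1r in g2.
move: ((-1) ^+ a) sg sgp u2 g2 => e sg sgp u2 g2.
have -> : p%:R / (a%:R + 1) * u * (s ^+ a + X - v * g)
     - (p%:R * (e * s ^+ a / (a%:R + 1)) + p%:R ^+ 2 * (s ^+ a.+1 / (a%:R + 1) * W))
  = p%:R ^+ 1 * ((a%:R + 1)^-1 * (s ^+ a * (u - e) + u * X
         - (((u - e) * v + e * (v - 1)) * g + e * (g - p%:R * (- e * s ^+ a.+1 * W)))
         + (e * e - 1) * p%:R * s ^+ a.+1 * W)).
  by rewrite expr1; field; exact: natS_neq0.
(* The term with [e * e - 1] is zero, [e] being the sign [(-1) ^ a]; every other
   term pairs one of the small differences with an integral factor. *)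
rewrite sg subrr !mul0r addr0 (p_idealpM 1 2) p_idealMl // rpredB //.
  by rewrite rpredD ?p_idealMl ?rpredX.
apply: rpredD; last exact: p_idealMl.
apply: p_idealMr (p_ideal_Zp g1); apply: rpredD; first exact: p_idealMr.
by apply: p_idealMl => //; apply: p_ideal_le v1.
Qed.

Lemma sum_clausen_sqr_mod4 :
  \sum_(0 <= k < p) (2 * k + 1)%:R * (\sum_(j < k.+1) clausen_coef k j * y ^+ j) ^+ 2
  - (p%:R * (4 * y) ^+ p.-1
     + p%:R ^+ 2 * \sum_(a < p.-1) (- (4 * y)) ^+ a / (a%:R + 1)
     + p%:R ^+ 3 * \sum_(n < m) (1 + 4 * y) ^+ n.+1 / (n%:R + 1) ^+ 2) \in p_ideal 4.
Proof.
have -> : \sum_(0 <= k < p) (2 * k + 1)%:R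
    * (\sum_(j < k.+1) clausen_coef k j * y ^+ j) ^+ 2
  = p%:R * cd_form lam p.+1 half_diff half_sum.
  apply: (@mulfI _ 2) => //.
  rewrite mulrCA -cd_form_half -(@christoffel_darboux lam p p) //; congr (_ * _).
  rewrite !big_nat; apply: eq_bigr => k /andP[_ ltk]; congr (_ * _ ^+ 2).
  have le_kp : (k.+1 <= p.+1)%N by lia.
  rewrite (big_ord_widen_cond p.+1 predT (fun j => clausen_coef k j * y ^+ j)) //.
  rewrite big_mkcond; apply: eq_bigr => j _ /=; rewrite /clausen_coef.
  by case: ltnP => [_|kj]; [ring | rewrite legendre_coef_small // mulr0].
have := cd_form_half_mod3; set F := cd_form _ _ _ _.
set S := _ ^+ p.-1; set P := \sum_(a < _) _; set Z := \sum_(n < m) _ => F3.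
have -> : p%:R * F - (p%:R * S + p%:R ^+ 2 * P + p%:R ^+ 3 * Z)
  = p%:R ^+ 1 * (F - (S + p%:R * P + p%:R ^+ 2 * Z)) by ring.
by rewrite (p_idealpM 1 3).
Qed.

Lemma p_ideal_expr u k : u \in p_ideal 1 -> u ^+ k \in p_ideal k.
Proof.
move=> u1; elim: k => [|k IHk]; first by rewrite p_ideal0 rpred1.
by rewrite exprS; apply: (p_idealM (j := 1)).
Qed.

Lemma bin_pred_mod (l : nat) : (l < p)%N -> 'C(p.-1, l)%:R - (-1) ^+ l \in p_ideal 1.
Proof.
elim: l => [|l IHl] ltl; first by rewrite bin0 subrr rpred0.
have {}IHl := IHl (ltnW ltl); have lp := int_localization_invS ltl.
have pp : p.-1.+1 = p by rewrite prednK ?prime_gt0.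
have e : 'C(p.-1, l)%:R + 'C(p.-1, l.+1)%:R
         = p%:R * ('C(p.-1, l)%:R / (l%:R + 1)) :> rat.
  have := binS_ratio p.-1 l; rewrite natr1 pp => <-.
  rewrite -{1}pp /= -natrD addnC -binS pp.
  by rewrite mulrC divfK ?p_neq0.
have -> : 'C(p.-1, l.+1)%:R - (-1) ^+ l.+1
  = p%:R * ('C(p.-1, l)%:R / (l%:R + 1)) - ('C(p.-1, l)%:R - (-1) ^+ l) :> rat.
  by rewrite -e exprS; ring.
by rewrite rpredB // p_idealMr ?p_ideal_p // rpredM ?rpred_nat.
Qed.

(** * Polylogarithms and the polynomial S2 *)

(** Expand both powers of [1 - x].  The constant term is [p] times the harmonic sum
    of [harmonic1]; in degree [l > 0] the two expansions add up to [p (- x) ^ l] times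
    [C(p, l) / l = (p / l ^ 2) C(p - 1, l - 1)], and [C(p - 1, l - 1)] is
    [(-1) ^ (l - 1)] modulo [p], which produces the sum of [x ^ l / l ^ 2]. *)
Lemma sum_log_mod3 x : x \in Zp ->
  p%:R * \sum_(a < p.-1) (1 - x) ^+ a.+1 / (a%:R + 1)
  - (1 - x ^+ p - (1 - x) ^+ p
     - p%:R ^+ 2 * \sum_(l < p.-1) x ^+ l.+1 / (l%:R + 1) ^+ 2) \in p_ideal 3.
Proof.
move=> xp; have pp : p.-1.+1 = p by rewrite prednK ?prime_gt0.
have p_odd : odd p by rewrite pE /= oddM.
have Cp l : 'C(p, l.+1)%:R = p%:R * ('C(p.-1, l)%:R / (l%:R + 1)) :> rat.
  have := binS_ratio p.-1 l; rewrite natr1 pp => <-.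
  by rewrite mulrC divfK ?p_neq0.
have Cp1 l : 'C(p.-1, l.+1)%:R = p%:R * ('C(p.-1, l)%:R / (l%:R + 1)) - 'C(p.-1, l)%:R :> rat.
  by rewrite -Cp -{2}pp binS natrD addrK.
rewrite (sum_expD1_ratio (- x)) (@binomialD1 _ (- x) p p) //.
rewrite (sum_to_p (fun l => 'C(p, l.+1)%:R * (- x) ^+ l.+1)) pp binn mul1r.
rewrite [(- x) ^+ p]exprNn -signr_odd p_odd expr1 mulN1r.
set H := \sum_(n < _) _; set L := \sum_(l < p.-1) x ^+ _ / _.
have -> : \sum_(l < p.-1) 'C(p, l.+1)%:R * (- x) ^+ l.+1
   = p%:R * \sum_(l < p.-1) 'C(p.-1, l)%:R / (l%:R + 1) * (- x) ^+ l.+1.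
  by rewrite mulr_sumr; apply: eq_bigr => l _; rewrite Cp; ring.
set M := \sum_(l < _) 'C(_, _)%:R / _ * _; set N := \sum_(l < _) 'C(_, _)%:R / _ * _.
have -> : p%:R * (H + M) - (1 - x ^+ p - (1 + (p%:R * N - x ^+ p)) - p%:R ^+ 2 * L)
  = p%:R ^+ 1 * H + p%:R ^+ 1 * (M + N + p%:R * L) by ring.
rewrite rpredD ?(p_idealpM 1 2) ?harmonic1 //.
have -> : M + N + p%:R * L = p%:R ^+ 1 * \sum_(l < p.-1) (('C(p.-1, l)%:R - (-1) ^+ l)
     * ((l%:R + 1)^-1 ^+ 2 * (- x) ^+ l.+1)).
  rewrite expr1 /M /N /L -big_split !mulr_sumr -big_split; apply: eq_bigr => l _ /=.
  have sgx : (- x) ^+ l.+1 = - (-1) ^+ l * x ^+ l.+1.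
    by rewrite (exprNn x) (exprS (-1)) mulN1r.
  have : (-1) ^+ l * (-1) ^+ l = 1 :> rat by rewrite -expr2 sqrr_sign.
  rewrite Cp1 sgx; move: ((-1) ^+ l) (x ^+ l.+1) => e X ee.
  transitivity (p%:R * ((l%:R + 1) ^- 2 * ((e * e) * X - 'C(p.-1, l)%:R * e * X))).
    by rewrite ee; field; exact: natS_neq0.
  by field; exact: natS_neq0.
rewrite (p_idealpM 1 1) rpred_sum // => l _; have ltl := ltn_ord l.
rewrite p_idealMr ?bin_pred_mod //; first by lia.
by rewrite rpredM ?rpredX ?rpredN ?int_localization_invS //; lia.
Qed.

(** The binomial sums collapse by the hockey-stick identity and
    [C(p - 1, l) + C(p - 1, l + 1) = C(p, l + 1)]. *)
Lemma coef_S2_poly (j : nat) : (S2_poly p)`_j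
   = if j is j'.+1 then - 4 * ('C(p.-1, (2 * j').+1)%:R / (2 * (j'%:R + 1)) ^+ 2)
     else - 4 / p%:R * \sum_(n < p.-1) (n%:R + 1)^-1.
Proof.
have pp : p.-1.+1 = p by rewrite prednK ?prime_gt0.
have p0 := p_neq0.
have cP i k : ((1 - 'X : {poly rat}) ^+ i + (1 + 'X) ^+ i)`_(2 * k) = 2 * 'C(i, 2 * k)%:R.
  rewrite coefD -scaleN1r coef_1DX_exp -['X]scale1r coef_1DX_exp.
  by rewrite expr1n exprM sqrrN !expr1n; ring.
rewrite /S2_poly coef_even_poly -mul2n /S2_sqrt coefZ coefB coefZ coef_sum.
rewrite -addrA -opprD coefB cP.
have -> : \sum_(1 <= i < p) (i%:R^-1 *: ((1 - 'X : {poly rat}) ^+ i + (1 + 'X) ^+ i))`_(2 * j)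
   = 2 * \sum_(n < p.-1) 'C(n.+1, 2 * j)%:R / (n%:R + 1).
  rewrite -{1}pp big_add1 big_mkord mulr_sumr; apply: eq_bigr => n _.
  by rewrite coefZ cP -natr1 /=; ring.
rewrite -polyC_natr coefC; case: j => [|j].
  rewrite muln0 bin0 /=; under eq_bigr do rewrite bin0 mul1r.
  by field.
have -> : (2 * j.+1 = (2 * j).+2)%N by lia.
rewrite sum_binS_ratio /= -[(2 * j).+1%:R]natr1 natrM.
have := binS_ratio p.-1 (2 * j).+1; rewrite pp natr1 pp -natr1 natrM => e.
have e2 : 'C(p, (2 * j).+2)%:R = 'C(p.-1, (2 * j).+2)%:R + 'C(p.-1, (2 * j).+1)%:R :> rat.
  by rewrite -{1}pp binS natrD.
have j0 : 2 * j%:R + 1 + 1 != 0 :> rat by rewrite -natrM !natr1 pnatr_eq0.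
have e3 : 'C(p.-1, (2 * j).+2)%:R = 'C(p, (2 * j).+2)%:R - 'C(p.-1, (2 * j).+1)%:R :> rat.
  by rewrite e2; ring.
have e4 : 'C(p, (2 * j).+2)%:R = p%:R * ('C(p.-1, (2 * j).+1)%:R / (2 * j%:R + 1 + 1)) :> rat.
  by rewrite -e; field.
by rewrite e3 e4; field; rewrite p0 j0 natS_neq0.
Qed.

(** The constant term is [-4 / p] times a harmonic sum divisible by [p ^ 2]; the
    other coefficients hold [C(p - 1, 2n - 1)], which is [-1] modulo [p]. *)
Lemma S2_mod_p x : x \in Zp ->
  S2 p x - \sum_(n < m) x ^+ n.+1 / (n%:R + 1) ^+ 2 \in p_ideal 1.
Proof.
move=> xp; rewrite /S2 (@horner_coef_wide _ m.+1); last first.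
  apply/leq_sizeP => -[|j] mj //; rewrite coef_S2_poly bin_small ?mul0r ?mulr0 //.
  by rewrite pE /=; lia.
rewrite big_ord_recl -addrA -sumrB coef_S2_poly; apply: rpredD.
  set H := \sum_(n < _) _; have H2 : H \in p_ideal 2 := harmonic1.
  have Hp : H / p%:R \in p_ideal 1.
    by rewrite -(p_idealpM 1) expr1 mulrC divfK ?p_neq0.
  have -> : - 4 / p%:R * H = - 4 * (H / p%:R) by ring.
  by rewrite expr0 mulr1 p_idealMl ?rpredN ?rpred_nat.
apply: rpred_sum => n _; have ltn := ltn_ord n.
rewrite [nat_of_ord (lift _ _)]/(bump _ _) /bump /= add1n coef_S2_poly.
have sg : (-1) ^+ (2 * n).+1 = -1 :> rat by rewrite exprS exprM sqrrN !expr1n mulr1.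
have ltn2 : ((2 * n).+1 < p)%N by lia.
have := bin_pred_mod ltn2; rewrite sg => C1.
have -> : - 4 * ('C(p.-1, (2 * n).+1)%:R / (2 * (n%:R + 1)) ^+ 2) * x ^+ n.+1
     - x ^+ n.+1 / (n%:R + 1) ^+ 2
  = - ((n%:R + 1)^-1 ^+ 2 * x ^+ n.+1) * ('C(p.-1, (2 * n).+1)%:R - -1).
  by field; exact: natS_neq0.
by rewrite p_idealMl // rpredN rpredM ?rpredX // int_localization_invS //; lia.
Qed.

(** * The three cases *)

Lemma sum_clausen_sqr_mod4_unit : y != 0 -> y^-1 \in Zp ->
  \sum_(0 <= k < p) (2 * k + 1)%:R * (\sum_(j < k.+1) clausen_coef k j * y ^+ j) ^+ 2
  - (p%:R * ((1 + 4 * y) ^+ p - 1) / (4 * y)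
     + p%:R ^+ 3 * (S2 p (1 + 4 * y) + L2 p (1 + 4 * y) / (4 * y))) \in p_ideal 4.
Proof.
move=> y0 yVp; have := sum_clausen_sqr_mod4; set S := \sum_(0 <= k < p) _.
have s0 : 4 * y != 0 by rewrite mulf_neq0.
have sp : 4 * y \in Zp by rewrite rpredM ?rpred_nat.
have sVp : (4 * y)^-1 \in Zp by rewrite invfM rpredM // invr_Zp //; lia.
have xp : 1 + 4 * y \in Zp by rewrite rpredD ?rpred1.
have p_odd : odd p by rewrite pE /= oddM.
have := sum_log_mod3 xp; have := S2_mod_p xp.
have -> : 1 - (1 + 4 * y) = - (4 * y) by ring.
have L2E : L2 p (1 + 4 * y)
    = \sum_(l < p.-1) (1 + 4 * y) ^+ l.+1 / (l%:R + 1) ^+ 2.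
  rewrite /L2 -{1}(prednK (prime_gt0 p_pr)) big_add1 big_mkord.
  by apply: eq_bigr => l _; rewrite natr1.
rewrite -L2E [(- (4 * y)) ^+ p]exprNn -signr_odd p_odd expr1 mulN1r.
have -> : \sum_(a < p.-1) (- (4 * y)) ^+ a.+1 / (a%:R + 1)
   = - (4 * y) * \sum_(a < p.-1) (- (4 * y)) ^+ a / (a%:R + 1).
  by rewrite mulr_sumr; apply: eq_bigr => a _; rewrite exprS mulrA.
have -> : (4 * y) ^+ p = 4 * y * (4 * y) ^+ p.-1.
  by rewrite -exprS prednK ?prime_gt0.
move: (4 * y) s0 sp sVp xp => s s0 sp sVp xp.
set P := \sum_(a < p.-1) _; set Z := \sum_(n < m) _; set sq := s ^+ p.-1.
set X := (1 + s) ^+ p; set L := L2 _ _; set Q := S2 _ _ => Q1 L3 S4.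
have -> : S - (p%:R * (X - 1) / s + p%:R ^+ 3 * (Q + L / s))
  = (S - (p%:R * sq + p%:R ^+ 2 * P + p%:R ^+ 3 * Z))
    - p%:R ^+ 1 * (s^-1 * (p%:R * (- s * P) - (1 - X - - (s * sq) - p%:R ^+ 2 * L)))
    - p%:R ^+ 3 * (Q - Z) by field.
apply: rpredB; last by rewrite (p_idealpM 3 1).
by apply: rpredB S4 _; rewrite (p_idealpM 1 3) p_idealMl.
Qed.

Lemma sum_clausen_sqr_dvd_c : y \in p_ideal 1 ->
  \sum_(0 <= k < p) (2 * k + 1)%:R * (\sum_(j < k.+1) clausen_coef k j * y ^+ j) ^+ 2
  - (p%:R ^+ 2 - p%:R ^+ 2 * (2 * y)) \in p_ideal 4.
Proof.
move=> y1; have := sum_clausen_sqr_mod4; set S := \sum_(0 <= k < p) _.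
have s1 : 4 * y \in p_ideal 1 by rewrite p_idealMl ?rpred_nat.
have -> : 2 * y = (4 * y) / 2 by field.
move: (4 * y) s1 (p_ideal_Zp s1) => s s1 sp.
set P := \sum_(a < _) _; set Z := \sum_(n < _) _ => S4.
have P2 : P - (1 - s / 2) \in p_ideal 2.
  have -> : P - (1 - s / 2) = \sum_(a < p.-2.-1) (- s) ^+ a.+2 / (a%:R + 3).
    have p3 : (p.-1 = p.-2.-1.+2)%N by lia.
    rewrite /P -(big_mkord predT (fun a => (- s) ^+ a / (a%:R + 1))) p3.
    rewrite !big_nat_recl // big_mkord expr0 expr1.
    rewrite (eq_bigr (fun a : 'I_(_) => (- s) ^+ a.+2 / (a%:R + 3))) => [|a _].
      by field.
    by rewrite -!natr1; congr (_ / _); ring.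
  rewrite rpred_sum // => a _; have lta := ltn_ord a; apply: p_idealMr.
    by apply: (@p_ideal_le 2 a.+2) => //; rewrite p_ideal_expr ?rpredN.
  have -> : a%:R + 3 = a.+2%:R + 1 :> rat by rewrite -!natr1; ring.
  by rewrite int_localization_invS //; lia.
have Z1 : Z \in p_ideal 1.
  have -> : Z = \sum_(n < m) (n%:R + 1)^-1 ^+ 2 * ((1 + s) ^+ n.+1 - 1)
               + \sum_(n < m) (n%:R + 1) ^- 2.
    by rewrite -big_split; apply: eq_bigr => n _ /=; field; exact: natS_neq0.
  rewrite rpredD ?half_harmonic2 // rpred_sum // => n _; have ltn := ltn_ord n.
  rewrite p_idealMl ?rpredX ?int_localization_invS //; first by lia.
  rewrite subrX1 addrAC subrr add0r p_idealMr // rpred_sum // => i _.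
  by rewrite rpredX ?rpredD ?rpred1.
have sq : s ^+ p.-1 \in p_ideal 3.
  by apply: (@p_ideal_le 3 p.-1); [lia | exact: p_ideal_expr].
have -> : S - (p%:R ^+ 2 - p%:R ^+ 2 * (s / 2)) =
  (S - (p%:R * s ^+ p.-1 + p%:R ^+ 2 * P + p%:R ^+ 3 * Z))
  + p%:R ^+ 1 * s ^+ p.-1 + p%:R ^+ 2 * (P - (1 - s / 2)) + p%:R ^+ 3 * Z by ring.
apply: rpredD; last by rewrite (p_idealpM 3 1).
apply: rpredD; last by rewrite (p_idealpM 2 2).
by apply: rpredD => //; rewrite (p_idealpM 1 3).
Qed.

Lemma sum_clausen_sqr_dvd_b : y != 0 -> y^-1 \in Zp -> 1 + 4 * y \in p_ideal 2 ->
  \sum_(0 <= k < p) (2 * k + 1)%:R * (\sum_(j < k.+1) clausen_coef k j * y ^+ j) ^+ 2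
  - (p%:R - p%:R * ((1 + 4 * y) / (4 * y))) \in p_ideal 4.
Proof.
move=> y0 yVp x2; have := sum_clausen_sqr_mod4_unit y0 yVp.
set S := \sum_(0 <= k < p) _; have xp := p_ideal_Zp x2.
have xX k : (1 + 4 * y) ^+ k.+1 \in p_ideal 2 by rewrite exprSr p_idealMl ?rpredX.
have s0 : 4 * y != 0 by rewrite mulf_neq0.
have sVp : (4 * y)^-1 \in Zp by rewrite invfM rpredM // invr_Zp //; lia.
have L1 : L2 p (1 + 4 * y) \in p_ideal 1.
  rewrite /L2 big_nat rpred_sum // => k /andP[k0 kp].
  have := xX k.-1; rewrite prednK // => xk.
  apply: p_idealMr; first exact: (p_ideal_le (k := 2)).
  by rewrite -exprVn rpredX ?invr_Zp ?k0.
have S21 : S2 p (1 + 4 * y) \in p_ideal 1.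
  rewrite -[X in X \in _](subrK (\sum_(n < m) (1 + 4 * y) ^+ n.+1 / (n%:R + 1) ^+ 2)).
  rewrite rpredD ?S2_mod_p // rpred_sum // => n _; have ltn := ltn_ord n.
  apply: p_idealMr; first exact: (p_ideal_le (k := 2)).
  by rewrite -exprVn rpredX ?int_localization_invS //; lia.
have xp3 : (1 + 4 * y) ^+ p \in p_ideal 3.
  apply: (@p_ideal_le 3 4) => //; have -> : p = ((2 * m).-1 + 2)%N by lia.
  by rewrite exprD p_idealMl ?rpredX // expr2; apply: (p_idealM (j := 2) (k := 2)).
have e : p%:R - p%:R * ((1 + 4 * y) / (4 * y)) = - p%:R / (4 * y) by field.
rewrite e; move: (4 * y) s0 sVp xp3 L1 S21 => s s0 sVp xp3 L1 S21.
set X := (1 + s) ^+ p in xp3 *; set L := L2 _ _ in L1 *; set Q := S2 _ _ in S21 * => S4.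
have -> : S - - p%:R / s = (S - (p%:R * (X - 1) / s + p%:R ^+ 3 * (Q + L / s)))
   + p%:R ^+ 1 * (s^-1 * X) + p%:R ^+ 3 * (Q + L / s) by field.
apply: rpredD; last by rewrite (p_idealpM 3 1) rpredD // p_idealMr.
by apply: rpredD => //; rewrite (p_idealpM 1 3) p_idealMl.
Qed.

(** Since [(1 + p q) ^ 2 / (1 + p r)] is
    [1 + p (2 q - r) + p ^ 2 (q - r) ^ 2] modulo [p ^ 3], and
    [x ^ p - 1 = s + x (x ^ (p - 1) - 1)]. *)
Lemma sum_clausen_sqr_coprime q r : y != 0 -> y^-1 \in Zp ->
  q \in Zp -> r \in Zp -> 1 + p%:R * r != 0 -> (1 + p%:R * r)^-1 \in Zp ->
  (1 + 4 * y) ^+ p.-1 = (1 + p%:R * q) ^+ 2 / (1 + p%:R * r) ->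
  \sum_(0 <= k < p) (2 * k + 1)%:R * (\sum_(j < k.+1) clausen_coef k j * y ^+ j) ^+ 2
  - (p%:R + p%:R ^+ 2 * ((1 + 4 * y) / (4 * y)) * (2 * q - r)
     + p%:R ^+ 3 * (S2 p (1 + 4 * y) + (4 * y)^-1 * L2 p (1 + 4 * y)
                    + (1 + 4 * y) / (4 * y) * (q - r) ^+ 2)) \in p_ideal 4.
Proof.
move=> y0 yVp qp rp u0 uVp xE; have := sum_clausen_sqr_mod4_unit y0 yVp.
set S := \sum_(0 <= k < p) _.
have s0 : 4 * y != 0 by rewrite mulf_neq0.
have sp : 4 * y \in Zp by rewrite rpredM ?rpred_nat.
have sVp : (4 * y)^-1 \in Zp by rewrite invfM rpredM // invr_Zp //; lia.
have -> : (1 + 4 * y) ^+ p = (1 + 4 * y) * (1 + 4 * y) ^+ p.-1.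
  by rewrite -exprS prednK ?prime_gt0.
rewrite xE; move: (4 * y) s0 sp sVp => s s0 sp sVp.
set L := L2 _ _; set Q := S2 _ _ => S4.
have -> : S - (p%:R + p%:R ^+ 2 * ((1 + s) / s) * (2 * q - r)
     + p%:R ^+ 3 * (Q + s^-1 * L + (1 + s) / s * (q - r) ^+ 2))
  = (S - (p%:R * ((1 + s) * ((1 + p%:R * q) ^+ 2 / (1 + p%:R * r)) - 1) / s
          + p%:R ^+ 3 * (Q + L / s)))
    - p%:R ^+ 4 * (s^-1 * (1 + s) * (1 + p%:R * r)^-1 * (r * (q - r) ^+ 2)).
  by field; rewrite s0 u0.
apply: rpredB => //; apply: p_idealMr (p_ideal_exp 4) _.
by rewrite !rpredM ?rpredX ?rpredB ?rpredD ?rpred1.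
Qed.

Lemma fermat_quotient_Zp (a : int) : ~~ (p%:Z %| a)%Z -> fermat_quotient p a \in Zp.
Proof.
move=> pa; have a0 : a%:~R != 0 :> rat.
  by apply: contraNneq pa => /eqP; rewrite intr_eq0 => /eqP ->; exact: dvdz0.
have : a%:~R * (a ^+ p.-1 - 1)%:~R \in p_ideal 1.
  rewrite rmorphB rmorphXn /= mulrBr mulr1 -exprS prednK ?prime_gt0 //.
  by rewrite fermat_Zp ?rpred_int.
by move/(p_ideal_cancel a0 (int_localization_invz pa)).
Qed.

Lemma fermat_quotientE (a : int) : a%:~R ^+ p.-1 = 1 + p%:R * fermat_quotient p a.
Proof.
rewrite /fermat_quotient rmorphB rmorphXn /= mulrC divfK ?p_neq0 //; ring.
Qed.

Lemma fermat_unit_Zp (a : int) : ~~ (p%:Z %| a)%Z ->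
  (1 + p%:R * fermat_quotient p a)^-1 \in Zp.
Proof.
by move=> pa; rewrite -fermat_quotientE -exprVn rpredX ?int_localization_invz.
Qed.

End PAdic.

Theorem theorem1 (p : nat) (b c d : int)
    (p_pr : prime p) (p_ge5 : (5 <= p)%N)
    (d_def : d = b ^+ 2 - 4 * c) (p_ndvd_d : ~~ (p%:Z %| d)%Z) :
  let B : rat := b%:~R in
  let C : rat := c%:~R in
  let D : rat := d%:~R in
  let x : rat := B ^+ 2 / D in
  let S : rat :=
    \sum_(0 <= k < p)
      (2 * k + 1)%:R * ((trinomial_coef k b c)%:~R ^+ 4 / D ^+ (2 * k)) in
  [/\ (p%:Z %| c)%Z ->
        eq_mod_loc p 4 S (p%:R ^+ 2 - p%:R ^+ 2 * (2 * C / D)),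
      (p%:Z %| b)%Z ->
        eq_mod_loc p 4 S (p%:R - p%:R * (B ^+ 2 / (4 * C)))
    & ~~ (p%:Z %| c)%Z -> ~~ (p%:Z %| b)%Z ->
        eq_mod_loc p 4 S
          (p%:R
           + p%:R ^+ 2 * (B ^+ 2 / (4 * C))
             * (2 * fermat_quotient p b - fermat_quotient p d)
           + p%:R ^+ 3
             * (S2 p x
                + D / (4 * C) * L2 p x
                + B ^+ 2 / (4 * C)
                  * (fermat_quotient p b - fermat_quotient p d) ^+ 2))].
Proof.
move=> B C D x S.
have [m pE] : exists m, p = (2 * m).+1.
  have p_odd : odd p.
    by case: (even_prime p_pr) => [p2|//]; rewrite p2 in p_ge5.
  by exists p./2; lia.
have intr_neq0 (a : int) : ~~ (p%:Z %| a)%Z -> a%:~R != 0 :> rat.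
  by apply: contraNneq => /eqP; rewrite intr_eq0 => /eqP ->; exact: dvdz0.
have D0 : D != 0 := intr_neq0 d p_ndvd_d.
have ratio_Zp (a e : int) : ~~ (p%:Z %| e)%Z -> a%:~R / e%:~R \in int_localization p.
  by move=> pe; apply/int_localizationP; exists a, e.
pose y := C / D; have yp : y \in int_localization p := ratio_Zp c d p_ndvd_d.
have xE : x = 1 + 4 * y.
  have DE : D = B ^+ 2 - 4 * C by rewrite /D d_def rmorphB rmorphXn rmorphM.
  by rewrite /x /y -[B ^+ 2](subrK (4 * C)) -DE; field.
have SE : S = \sum_(0 <= k < p) (2 * k + 1)%:R
    * (\sum_(j < k.+1) clausen_coef k j * y ^+ j) ^+ 2.
  apply: eq_bigr => k _; congr (_ * _).
  rewrite (exprM _ 2 2) (trinomial_coef_sqr k d_def) -?(intr_eq0 rat) //.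
  by rewrite exprMn mulnC exprM -/D -/C -/y; field; rewrite expf_neq0.
have unit_y : ~~ (p%:Z %| c)%Z -> y != 0 /\ y^-1 \in int_localization p.
  move=> pc; split; first by rewrite mulf_neq0 ?invr_eq0 ?intr_neq0.
  by rewrite invf_div ratio_Zp.
have xsE : C != 0 -> x / (4 * y) = B ^+ 2 / (4 * C).
  by move=> C0; rewrite /x /y; field; rewrite C0 D0.
split=> [pc|pb|pc pb]; apply: (eq_mod_locP p_pr); rewrite SE.
- have -> : 2 * C / D = 2 * y by rewrite /y mulrA.
  apply: (sum_clausen_sqr_dvd_c p_pr pE p_ge5 yp).
  rewrite /y mulrC; apply: p_idealMl => //; last exact: p_ideal_dvdz.
  by rewrite -[D^-1]mul1r (ratio_Zp 1).
- have pc : ~~ (p%:Z %| c)%Z.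
    (* A prime dividing [b] and [c] would divide [d]. *)
    apply: contra p_ndvd_d => pc; rewrite d_def expr2.
    by apply: rpredB; [exact: dvdz_mulr | exact: dvdz_mull].
  have [y0 yVp] := unit_y pc.
  rewrite -(xsE (intr_neq0 c pc)) xE.
  apply: (sum_clausen_sqr_dvd_b p_pr pE p_ge5 yp y0 yVp).
  rewrite -xE /x mulrC; apply: p_idealMl => //.
    by rewrite -[D^-1]mul1r (ratio_Zp 1).
  by rewrite expr2; apply: (p_idealM p_pr (j := 1) (k := 1)); apply: p_ideal_dvdz.
have [y0 yVp] := unit_y pc.
have sVE : D / (4 * C) = (4 * y)^-1 by rewrite -invf_div /y mulrA.
have uE := fermat_quotientE p_pr.
rewrite -(xsE (intr_neq0 c pc)) sVE xE.
apply: (sum_clausen_sqr_coprime p_pr pE p_ge5 yp y0 yVp).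
- exact: (fermat_quotient_Zp p_pr pE).
- exact: (fermat_quotient_Zp p_pr pE).
- by rewrite -uE expf_neq0.
- exact: fermat_unit_Zp.
by rewrite -xE -!uE /x expr_div_n -!exprM mulnC.
Qed.
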